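(* Let $B$ be a right perfect bialgebra over a field $\Bbbk$. Then $\mathrm{C}(B)=K^\infty(B)$; that is, the sub-bialgebra $K^\infty(B)$ of $B$ is a Hopf algebra and, together with its inclusion into $B$, it is the cofree Hopf algebra on $B$.
   Context: A bialgebra is right perfect if its underlying algebra satisfies the descending chain condition on principal left ideals. For a bialgebra $B$ over a field $\Bbbk$ put $(B\otimes B)^{\mathrm{co}B}:=\{\sum_i x^i\otimes y_i\in B\otimes B \mid \sum_i x^i_1\otimes (y_i)_1\otimes x^i_2(y_i)_2=\sum_i x^i\otimes y_i\otimes 1\}$, $p_B\colon (B\otimes B)^{\mathrm{co}B}\to B$, $\sum_i x^i\otimes y_i\mapsto\sum_i x^i\varepsilon(y_i)$, and $K(B):=\{b\in B\mid\Delta(b)\in\mathrm{im}(p_B)\otimes B\}$, a sub-bialgebra of $B$. Set $K^0(B)=B$, $K^{m+1}(B)=K(K^m(B))$ and $K^\infty(B):=\varprojlim_m K^m(B)=\bigcap_{m\in\mathbb{N}}K^m(B)$, the inverse limit along the inclusions, which is a sub-bialgebra of $B$. The cofree Hopf algebra on $B$ is a Hopf algebra $\mathrm{C}(B)$ with a bialgebra map $\epsilon_B\colon\mathrm{C}(B)\to B$ such that for every Hopf algebra $H$ and every bialgebra map $f\colon H\to B$ there is a unique Hopf algebra map $\tilde f\colon H\to\mathrm{C}(B)$ with $\epsilon_B\circ\tilde f=f$. *)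

(* Defs.v *)
From HB Require Import structures.
From mathcomp Require Import all_boot all_order all_algebra.
From mathcomp Require Import generic_quotient.
From mathcomp Require Import boolp classical_sets.

Set Implicit Arguments.
Unset Strict Implicit.
Unset Printing Implicit Defensive.

Import GRing.Theory.
Local Open Scope quotient_scope.
Local Open Scope ring_scope.

Reserved Notation "V ⊗ W" (at level 40, left associativity).

Section Tensor.
Variables (k : fieldType) (V W : lmodType k).

(* A list [:: (x1, y1); ...; (xn, yn)] stands for the sum of the xi ⊗ yi. The
   scalars of the free module on V * W are absorbed in the first component. *)
Inductive tens_eq : seq (V * W) -> seq (V * W) -> Prop :=
| tens_eq_refl s : tens_eq s s
| tens_eq_sym s t : tens_eq s t -> tens_eq t s
| tens_eq_trans s t u : tens_eq s t -> tens_eq t u -> tens_eq s u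
| tens_eq_cat s s' t t' :
    tens_eq s s' -> tens_eq t t' -> tens_eq (s ++ t) (s' ++ t')
| tens_eq_catC s t : tens_eq (s ++ t) (t ++ s)
| tens_eq_addl x x' y : tens_eq [:: (x + x', y)] [:: (x, y); (x', y)]
| tens_eq_addr x y y' : tens_eq [:: (x, y + y')] [:: (x, y); (x, y')]
| tens_eq_scale a x y : tens_eq [:: (a *: x, y)] [:: (x, a *: y)]
| tens_eq_zero y : tens_eq [:: (0, y)] [::].

Definition tens_eqb (s t : seq (V * W)) : bool := `[< tens_eq s t >].

Lemma tens_eqb_refl : reflexive tens_eqb.
Proof. by move=> s; apply/asboolP; constructor. Qed.

Lemma tens_eqb_sym : symmetric tens_eqb.
Proof. by move=> s t; apply: asbool_equiv_eq; split; apply: tens_eq_sym. Qed.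

Lemma tens_eqb_trans : transitive tens_eqb.
Proof.
by move=> t s u /asboolP st /asboolP tu; apply/asboolP; apply: tens_eq_trans tu.
Qed.

Canonical tens_equiv :=
  EquivRel tens_eqb tens_eqb_refl tens_eqb_sym tens_eqb_trans.

Definition tens : Type := {eq_quot tens_equiv}.
HB.instance Definition _ := Choice.on tens.

Definition tens_of (s : seq (V * W)) : tens := \pi_{eq_quot tens_equiv} s.
Definition tens_repr (t : tens) : seq (V * W) :=
  repr (t : {eq_quot tens_equiv}).
Definition pure (x : V) (y : W) : tens := tens_of [:: (x, y)].

Lemma tens_ofP s t : tens_of s = tens_of t <-> tens_eq s t.
Proof.
by split=> [/eqmodP /asboolP | st] //; apply/eqmodP/asboolP.
Qed.

Lemma tens_reprK t : tens_of (tens_repr t) = t.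
Proof. exact: reprK. Qed.

Lemma tens_repr_eq s : tens_eq (tens_repr (tens_of s)) s.
Proof. by apply/tens_ofP; rewrite tens_reprK. Qed.

Definition zero_tens : tens := tens_of [::].
Definition add_tens (t u : tens) : tens :=
  tens_of (tens_repr t ++ tens_repr u).
Definition scale_seq (a : k) (s : seq (V * W)) : seq (V * W) :=
  [seq (a *: p.1, p.2) | p <- s].
Definition scale_tens (a : k) (t : tens) : tens :=
  tens_of (scale_seq a (tens_repr t)).
Definition opp_tens (t : tens) : tens := scale_tens (-1) t.

Lemma add_tens_of s t : add_tens (tens_of s) (tens_of t) = tens_of (s ++ t).
Proof. by apply/tens_ofP; apply: tens_eq_cat; apply: tens_repr_eq. Qed.

Lemma scale_seq_eq a s t :
  tens_eq s t -> tens_eq (scale_seq a s) (scale_seq a t).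
Proof.
elim=> {s t} /=.
- by constructor.
- by move=> s t _; apply: tens_eq_sym.
- by move=> s t u _ st _; apply: tens_eq_trans.
- by move=> s s' t t' _ ss' _ tt'; rewrite /scale_seq !map_cat; apply: tens_eq_cat.
- by move=> s t; rewrite /scale_seq !map_cat; apply: tens_eq_catC.
- by move=> x x' y; rewrite scalerDr; apply: tens_eq_addl.
- by move=> x y y'; apply: tens_eq_addr.
- by move=> b x y; rewrite !scalerA mulrC -scalerA; apply: tens_eq_scale.
- by move=> y; rewrite scaler0; apply: tens_eq_zero.
Qed.

Lemma scale_tens_of a s : scale_tens a (tens_of s) = tens_of (scale_seq a s).
Proof. by apply/tens_ofP; apply/scale_seq_eq/tens_repr_eq. Qed.

Lemma add_tensA : associative add_tens.
Proof.
move=> t u v; rewrite -[t]tens_reprK -[u]tens_reprK -[v]tens_reprK.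
by rewrite !add_tens_of catA.
Qed.

Lemma add_tensC : commutative add_tens.
Proof.
by move=> t u; apply/tens_ofP; apply: tens_eq_catC.
Qed.

Lemma add_0tens : left_id zero_tens add_tens.
Proof. by move=> t; rewrite -[t]tens_reprK add_tens_of. Qed.

Lemma scale_seqDl a b s :
  tens_eq (scale_seq (a + b) s) (scale_seq a s ++ scale_seq b s).
Proof.
elim: s => [|[x y] s IHs]; first by constructor.
rewrite /= scalerDl -cat1s.
apply: tens_eq_trans (tens_eq_cat (tens_eq_addl _ _ _) IHs) _.
rewrite /= -cat1s -[X in tens_eq _ X]cat1s; apply: tens_eq_cat; first by constructor.
rewrite -cat1s -[(_, _) :: scale_seq b s]cat1s !catA.
by apply: tens_eq_cat; [apply: tens_eq_catC | constructor].
Qed.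

Lemma scale_seq0 s : tens_eq (scale_seq 0 s) [::].
Proof.
elim: s => [|[x y] s IHs]; first by constructor.
rewrite /= scale0r -cat1s.
exact: tens_eq_trans (tens_eq_cat (tens_eq_zero _) IHs) (tens_eq_refl _).
Qed.

Lemma scale_seq1 s : scale_seq 1 s = s.
Proof. by elim: s => [|[x y] s IHs] //=; rewrite scale1r IHs. Qed.

Lemma add_Ntens : left_inverse zero_tens opp_tens add_tens.
Proof.
move=> t; rewrite -[t]tens_reprK /opp_tens scale_tens_of add_tens_of.
set s := tens_repr t; apply/tens_ofP; rewrite -[X in _ ++ X]scale_seq1.
apply: tens_eq_trans (tens_eq_sym (scale_seqDl _ _ _)) _.
by rewrite addNr; apply: scale_seq0.
Qed.

HB.instance Definition _ :=
  GRing.isZmodule.Build tens add_tensA add_tensC add_0tens add_Ntens.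

Lemma scale_tensA a b t : scale_tens a (scale_tens b t) = scale_tens (a * b) t.
Proof.
rewrite -[t]tens_reprK !scale_tens_of; congr tens_of.
by rewrite /scale_seq -map_comp; apply: eq_map => p /=; rewrite scalerA.
Qed.

Lemma scale_1tens : left_id 1 scale_tens.
Proof. by move=> t; rewrite -[t]tens_reprK scale_tens_of scale_seq1. Qed.

Lemma scale_tensDr : right_distributive scale_tens +%R.
Proof.
move=> a t u; rewrite -[t]tens_reprK -[u]tens_reprK.
by rewrite [_ + _]add_tens_of !scale_tens_of [RHS]add_tens_of /scale_seq map_cat.
Qed.

Lemma scale_tensDl t : {morph scale_tens^~ t : a b / a + b}.
Proof.
move=> a b; rewrite -[t]tens_reprK !scale_tens_of [RHS]add_tens_of.
by apply/tens_ofP; apply: scale_seqDl.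
Qed.

HB.instance Definition _ := GRing.Zmodule_isLmodule.Build k tens
  scale_tensA scale_1tens scale_tensDr scale_tensDl.

Lemma tens_ofD s t : tens_of s + tens_of t = tens_of (s ++ t).
Proof. exact: add_tens_of. Qed.

Lemma tens_ofZ a s : a *: tens_of s = tens_of (scale_seq a s).
Proof. exact: scale_tens_of. Qed.

Lemma pure_is_bilinear : bilinear_for *:%R *:%R pure.
Proof.
split=> [y a x x' | x a y y'] /=.
- rewrite /pure tens_ofZ tens_ofD.
  by apply/tens_ofP; apply: tens_eq_addl.
- rewrite /pure tens_ofZ tens_ofD; apply/tens_ofP.
  apply: tens_eq_trans (tens_eq_addr _ _ _) _.
  rewrite -[X in tens_eq X _]cat1s; apply: tens_eq_cat; last by constructor.
  by apply: tens_eq_sym; apply: tens_eq_scale.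
Qed.

HB.instance Definition _ :=
  bilinear_isBilinear.Build k V W tens *:%R *:%R pure pure_is_bilinear.

Lemma tens_ofE s : tens_of s = \sum_(p <- s) pure p.1 p.2.
Proof.
elim: s => [|[x y] s IHs]; first by rewrite big_nil.
by rewrite big_cons -IHs tens_ofD.
Qed.

Lemma tensE t : t = \sum_(p <- tens_repr t) pure p.1 p.2.
Proof. by rewrite -tens_ofE tens_reprK. Qed.

Lemma tens_ind (P : tens -> Prop) :
  P 0 -> (forall x y t, P t -> P (pure x y + t)) -> forall t, P t.
Proof.
move=> P0 PD t; rewrite [t]tensE.
elim: (tens_repr t) => [|p s IHs]; first by rewrite big_nil.
by rewrite big_cons; apply: PD.
Qed.

(* The linear map induced by f when f is bilinear; otherwise it depends on the
   choice of representatives and has no meaning. *)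
Definition tens_lift (U : lmodType k) (f : V -> W -> U) (t : tens) : U :=
  \sum_(p <- tens_repr t) f p.1 p.2.

Section Lift.
Variables (U : lmodType k) (f : V -> W -> U).
Hypothesis f_bil : bilinear_for *:%R *:%R f.

Let fD x x' y : f (x + x') y = f x y + f x' y.
Proof. by have /= := f_bil.1 y 1 x x'; rewrite !scale1r. Qed.
Let fDr x y y' : f x (y + y') = f x y + f x y'.
Proof. by have /= := f_bil.2 x 1 y y'; rewrite !scale1r. Qed.
Let f0 y : f 0 y = 0.
Proof. by apply: (addrI (f 0 y)); rewrite -fD !addr0. Qed.
Let f0r x : f x 0 = 0.
Proof. by apply: (addrI (f x 0)); rewrite -fDr !addr0. Qed.
Let fZ a x y : f (a *: x) y = a *: f x y.
Proof. by have /= := f_bil.1 y a x 0; rewrite !addr0 f0 addr0. Qed.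
Let fZr a x y : f x (a *: y) = a *: f x y.
Proof. by have /= := f_bil.2 x a y 0; rewrite !addr0 f0r addr0. Qed.

Lemma tens_lift_eq s t : tens_eq s t ->
  \sum_(p <- s) f p.1 p.2 = \sum_(p <- t) f p.1 p.2.
Proof.
elim=> {s t} //=.
- by move=> s t u _ -> _ ->.
- by move=> s s' t t' _ ss' _ tt'; rewrite !big_cat /= ss' tt'.
- by move=> s t; rewrite !big_cat /= addrC.
- by move=> x x' y; rewrite !big_cons big_nil /= fD addrA.
- by move=> x y y'; rewrite !big_cons big_nil /= fDr addrA.
- by move=> a x y; rewrite !big_seq1 /= fZ fZr.
- by move=> y; rewrite big_seq1 big_nil /= f0.
Qed.

Lemma tens_lift_of s : tens_lift f (tens_of s) = \sum_(p <- s) f p.1 p.2.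
Proof. exact: tens_lift_eq (tens_repr_eq s). Qed.

Lemma tens_lift_pure x y : tens_lift f (pure x y) = f x y.
Proof. by rewrite tens_lift_of big_seq1. Qed.

Lemma tens_lift_is_linear : linear (tens_lift f).
Proof.
move=> a t u; rewrite -[t]tens_reprK -[u]tens_reprK.
rewrite tens_ofZ tens_ofD !tens_lift_of.
rewrite big_cat /= big_map scaler_sumr; congr (_ + _).
by apply: eq_bigr => p _ /=; rewrite fZ.
Qed.

End Lift.

Lemma tens_lift_comb (U : lmodType k) (f g : V -> W -> U) a t :
  tens_lift (fun x y => a *: f x y + g x y) t =
  a *: tens_lift f t + tens_lift g t.
Proof. by rewrite /tens_lift big_split scaler_sumr. Qed.

Lemma eq_tens_lift (U : lmodType k) (f g : V -> W -> U) t :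
  (forall x y, f x y = g x y) -> tens_lift f t = tens_lift g t.
Proof. by move=> fg; apply: eq_bigr => p _. Qed.

Lemma tens_ext (U : lmodType k) (f g : tens -> U) : linear f -> linear g ->
  (forall x y, f (pure x y) = g (pure x y)) -> forall t, f t = g t.
Proof.
move=> fL gL fg; have f0 h : linear h -> h 0 = 0 :> U.
  by move=> hL; have := hL (-1) 0 0; rewrite scaler0 addr0 scaleN1r addNr.
apply: tens_ind => [|x y t IHt]; first by rewrite !f0.
by have := fL 1 (pure x y) t; have := gL 1 (pure x y) t;
  rewrite !scale1r fg IHt => -> ->.
Qed.

End Tensor.

Notation "V ⊗ W" := (tens V%type W%type) : type_scope.
Notation "x ⊗ y" := (pure x y) : ring_scope.

Section TensorMaps.
Variable k : fieldType.

Definition tens_map (V W V' W' : lmodType k) (f : V -> V') (g : W -> W') :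
  V ⊗ W -> V' ⊗ W' := tens_lift (fun x y => f x ⊗ g y).

Lemma tens_map_bil (V W V' W' : lmodType k)
    (f : {linear V -> V'}) (g : {linear W -> W'}) :
  bilinear_for *:%R *:%R (fun x y => f x ⊗ g y).
Proof.
by split=> [y a x x' | x a y y'] /=;
  rewrite linearP ?(pure_is_bilinear _ _).1 ?(pure_is_bilinear _ _).2.
Qed.

Lemma tens_map_pure (V W V' W' : lmodType k)
    (f : {linear V -> V'}) (g : {linear W -> W'}) x y :
  tens_map f g (x ⊗ y) = f x ⊗ g y.
Proof. exact/tens_lift_pure/tens_map_bil. Qed.

HB.instance Definition _ (V W V' W' : lmodType k)
    (f : {linear V -> V'}) (g : {linear W -> W'}) :=
  GRing.isLinear.Build k (V ⊗ W)%type (V' ⊗ W')%type _ (tens_map f g)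
    (tens_lift_is_linear (tens_map_bil f g)).

Definition tens_assoc (U V W : lmodType k) : (U ⊗ V) ⊗ W -> U ⊗ (V ⊗ W) :=
  tens_lift (fun t z => tens_lift (fun x y => x ⊗ (y ⊗ z)) t).

Lemma tens_assoc_bil1 (U V W : lmodType k) (z : W) :
  bilinear_for *:%R *:%R (fun (x : U) (y : V) => x ⊗ (y ⊗ z)).
Proof.
by split=> [y a x x' | x a y y'] /=;
  rewrite !(pure_is_bilinear _ _).1 ?(pure_is_bilinear _ _).2.
Qed.

Lemma tens_assoc_bil (U V W : lmodType k) : bilinear_for *:%R *:%R
  (fun (t : U ⊗ V) (z : W) => tens_lift (fun x y => x ⊗ (y ⊗ z)) t).
Proof.
split=> [z|t] /=; first exact: tens_lift_is_linear (tens_assoc_bil1 _ _ z).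
move=> a z z'; rewrite -tens_lift_comb; apply: eq_tens_lift => x y.
by rewrite !(pure_is_bilinear _ _).2.
Qed.

Lemma tens_assoc_pure (U V W : lmodType k) (x : U) (y : V) (z : W) :
  tens_assoc ((x ⊗ y) ⊗ z) = x ⊗ (y ⊗ z).
Proof.
by rewrite /tens_assoc (tens_lift_pure (tens_assoc_bil _ _ _))
  (tens_lift_pure (tens_assoc_bil1 _ _ _)).
Qed.

HB.instance Definition _ (U V W : lmodType k) :=
  GRing.isLinear.Build k ((U ⊗ V) ⊗ W)%type (U ⊗ (V ⊗ W))%type _ (@tens_assoc U V W)
    (tens_lift_is_linear (tens_assoc_bil U V W)).

End TensorMaps.

(* Only a possibly zero ring (pzRingType), so A ⊗ A' is not an algType here. *)
Section TensorRing.
Variables (k : fieldType) (A A' : algType k).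

Definition one_tens : A ⊗ A' := 1 ⊗ 1.
Definition mul_tens (t u : A ⊗ A') : A ⊗ A' :=
  tens_lift (fun a b => tens_lift (fun c d => (a * c) ⊗ (b * d)) u) t.

Lemma mul_tens_bil1 (a : A) (b : A') :
  bilinear_for *:%R *:%R (fun c d => (a * c) ⊗ (b * d)).
Proof.
by split=> [y e x x' | x e y y'] /=; rewrite mulrDr -scalerAr
  ?(pure_is_bilinear _ _).1 ?(pure_is_bilinear _ _).2.
Qed.

Lemma mul_tens_bil2 (u : A ⊗ A') : bilinear_for *:%R *:%R
  (fun a b => tens_lift (fun c d => (a * c) ⊗ (b * d)) u).
Proof.
split=> [b e a a' | a e b b'] /=; rewrite -tens_lift_comb;
  apply: eq_tens_lift => c d; rewrite mulrDl -scalerAl;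
  by rewrite ?(pure_is_bilinear _ _).1 ?(pure_is_bilinear _ _).2.
Qed.

Lemma mul_tens_pure a b c d : mul_tens (a ⊗ b) (c ⊗ d) = (a * c) ⊗ (b * d).
Proof.
by rewrite /mul_tens (tens_lift_pure (mul_tens_bil2 _))
  (tens_lift_pure (mul_tens_bil1 _ _)).
Qed.

Lemma mul_tens_linearl u : linear (mul_tens^~ u).
Proof. exact: tens_lift_is_linear (mul_tens_bil2 u). Qed.

Lemma mul_tens_linearr t : linear (mul_tens t).
Proof.
move=> e u u'; rewrite /mul_tens -tens_lift_comb; apply: eq_tens_lift => a b.
exact: tens_lift_is_linear (mul_tens_bil1 a b) _ _ _.
Qed.

Lemma mul_tensDl : left_distributive mul_tens +%R.
Proof. by move=> t t' u; have := mul_tens_linearl u 1 t t'; rewrite !scale1r. Qed.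

Lemma mul_tensDr : right_distributive mul_tens +%R.
Proof. by move=> t u u'; have := mul_tens_linearr t 1 u u'; rewrite !scale1r. Qed.

Lemma mul_1tens : left_id one_tens mul_tens.
Proof.
apply: tens_ext => [||c d]; [exact: mul_tens_linearr | by [] |].
by rewrite mul_tens_pure !mul1r.
Qed.

Lemma mul_tens1 : right_id one_tens mul_tens.
Proof.
apply: tens_ext => [||a b]; [exact: mul_tens_linearl | by [] |].
by rewrite mul_tens_pure !mulr1.
Qed.

Lemma mul_tensA : associative mul_tens.
Proof.
move=> t u v.
apply: (tens_ext (f := fun t => mul_tens t (mul_tens u v))
  (g := fun t => mul_tens (mul_tens t u) v) _ _ _ t) => [||a b] /=.
- exact: mul_tens_linearl.
- by move=> e t1 t2; rewrite !mul_tens_linearl.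
apply: (tens_ext (f := fun u => mul_tens (a ⊗ b) (mul_tens u v))
  (g := fun u => mul_tens (mul_tens (a ⊗ b) u) v) _ _ _ u) => [||c d] /=.
- by move=> e t1 t2; rewrite mul_tens_linearl mul_tens_linearr.
- by move=> e t1 t2; rewrite mul_tens_linearr mul_tens_linearl.
apply: (tens_ext (f := fun v => mul_tens (a ⊗ b) (mul_tens (c ⊗ d) v))
  (g := fun v => mul_tens (mul_tens (a ⊗ b) (c ⊗ d)) v) _ _ _ v) => [||x y] /=.
- by move=> e t1 t2; rewrite !mul_tens_linearr.
- exact: mul_tens_linearr.
by rewrite !mul_tens_pure !mulrA.
Qed.

HB.instance Definition _ := GRing.Zmodule_isPzRing.Build (A ⊗ A')%type
  mul_tensA mul_1tens mul_tens1 mul_tensDl mul_tensDr.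

End TensorRing.

HB.mixin Record isBialgebra (k : fieldType) B of GRing.Algebra k B := {
  comul : {linear B -> (B ⊗ B)%type};
  counit : {linear B -> k | *%R};
  comulA : forall b : B, tens_assoc (tens_map comul idfun (comul b)) =
    tens_map idfun comul (comul b);
  counitl : forall b : B,
    tens_lift (fun x y => counit x *: y) (comul b) = b;
  counitr : forall b : B,
    tens_lift (fun x y => counit y *: x) (comul b) = b;
  comul_monoid_morphism : monoid_morphism comul;
  counit_monoid_morphism : monoid_morphism counit;
}.

#[short(type="bialgType")]
HB.structure Definition Bialgebra (k : fieldType) :=
  {B of isBialgebra k B & GRing.Algebra k B}.

HB.mixin Record isHopfAlgebra (k : fieldType) H of Bialgebra k H := {
  antipode : {linear H -> H};
  antipodel : forall h : H,
    tens_lift (fun x y => antipode x * y) (comul h) = (counit h)%:A;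
  antipoder : forall h : H,
    tens_lift (fun x y => x * antipode y) (comul h) = (counit h)%:A;
}.

#[short(type="hopfType")]
HB.structure Definition HopfAlgebra (k : fieldType) :=
  {H of isHopfAlgebra k H & Bialgebra k H}.

Section Morphisms.
Variable k : fieldType.

Definition bialg_morphism (A B : bialgType k) (f : {lrmorphism A -> B}) : Prop :=
  (forall a, comul (f a) = tens_map f f (comul a)) /\
  (forall a, counit (f a) = counit a).

Definition hopf_morphism (H H' : hopfType k) (f : {lrmorphism H -> H'}) : Prop :=
  bialg_morphism f /\ (forall h, f (antipode h) = antipode (f h)).

Local Open Scope classical_set_scope.

(* A sub-bialgebra S of B is presented by an injective bialgebra map with
   image S. The bialgebra structure transported to S does not depend on it. *)
Definition subbialg (A B : bialgType k) (j : {lrmorphism A -> B}) (S : set B) :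
  Prop := [/\ bialg_morphism j, injective j & range j = S].

End Morphisms.

Section CofreeConstruction.
Variable k : fieldType.
Local Open Scope classical_set_scope.

Definition right_perfect (B : bialgType k) : Prop :=
  forall a : nat -> B,
    (forall n, range (fun b : B => b * a n.+1) `<=` range (fun b : B => b * a n)) ->
  exists N, forall n, (N <= n)%N ->
    range (fun b : B => b * a n) = range (fun b : B => b * a N).

(* x ⊗ y |-> x_1 ⊗ y_1 ⊗ x_2 y_2 *)
Definition coaction (B : bialgType k) (t : B ⊗ B) : (B ⊗ B) ⊗ B :=
  tens_lift (fun x y =>
    tens_lift (fun x1 x2 =>
      tens_lift (fun y1 y2 => (x1 ⊗ y1) ⊗ (x2 * y2)) (comul y)) (comul x)) t.

Definition coinvariants (B : bialgType k) : set (B ⊗ B) :=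
  [set t | coaction t = t ⊗ (1 : B)].

Definition pB (B : bialgType k) (t : B ⊗ B) : B :=
  tens_lift (fun x y => counit y *: x) t.

Definition im_pB (B : bialgType k) : set B := @pB B @` @coinvariants B.

(* The subspace S ⊗ W of V ⊗ W. *)
Definition tens_subl (V W : lmodType k) (S : set V) : set (V ⊗ W) :=
  [set t | exists2 s : seq (V * W),
     (forall p, p \in s -> S p.1) & t = \sum_(p <- s) p.1 ⊗ p.2].

Definition K (B : bialgType k) : set B :=
  [set b | tens_subl (@im_pB B) (comul b)].

(* K^(m+1)(B) is the image of K(A), where A is the bialgebra K^m(B). *)
Fixpoint Kiter (B : bialgType k) (m : nat) : set B :=
  if m is m'.+1 then
    [set b | exists (A : bialgType k) (j : {lrmorphism A -> B}),
       subbialg j (Kiter m') /\ (j @` @K A) b]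
  else setT.

Definition Kinfty (B : bialgType k) : set B := \bigcap_m @Kiter B m.

Definition is_cofree_hopf (B : bialgType k) (C : hopfType k)
    (eps : {lrmorphism C -> B}) : Prop :=
  bialg_morphism eps /\
  forall (H : hopfType k) (f : {lrmorphism H -> B}), bialg_morphism f ->
    exists g : {lrmorphism H -> C},
      [/\ hopf_morphism g, eps \o g =1 f &
          forall g' : {lrmorphism H -> C},
            hopf_morphism g' -> eps \o g' =1 f -> g' =1 g].

End CofreeConstruction.

Arguments coinvariants {k} B.
Arguments im_pB {k} B.
Arguments K {k} B.
Arguments Kiter {k} B m.
Arguments Kinfty {k} B.

Section Bilinearity.
Variables (k : fieldType) (B : bialgType k).

Lemma coaction_bil1 (x1 x2 : B) :
  bilinear_for *:%R *:%R (fun y1 y2 : B => (x1 ⊗ y1) ⊗ (x2 * y2)).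
Proof.
by split=> [z a y y' | z a y y'] /=; rewrite ?mulrDr -?scalerAr
  ?(pure_is_bilinear _ _).2 ?(pure_is_bilinear _ _).1 ?(pure_is_bilinear _ _).2.
Qed.

Lemma coaction_bil2 (u : B ⊗ B) : bilinear_for *:%R *:%R
  (fun x1 x2 : B => tens_lift (fun y1 y2 : B => (x1 ⊗ y1) ⊗ (x2 * y2)) u).
Proof.
split=> [z a y y' | z a y y'] /=; rewrite -tens_lift_comb;
  apply: eq_tens_lift => p q; rewrite ?mulrDl -?scalerAl;
  by rewrite ?(pure_is_bilinear _ _).1 ?(pure_is_bilinear _ _).2.
Qed.

Lemma coaction_bil : bilinear_for *:%R *:%R (fun x y : B =>
  tens_lift (fun x1 x2 : B =>
    tens_lift (fun y1 y2 : B => (x1 ⊗ y1) ⊗ (x2 * y2)) (comul y)) (comul x)).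
Proof.
split=> [y a x x' | x a y y'] /=.
  by rewrite linearP; apply: tens_lift_is_linear (coaction_bil2 _) _ _ _.
rewrite -tens_lift_comb; apply: eq_tens_lift => x1 x2.
by rewrite linearP; apply: tens_lift_is_linear (coaction_bil1 _ _) _ _ _.
Qed.

Lemma pB_bil : bilinear_for *:%R *:%R (fun x y : B => counit y *: x).
Proof.
split=> [y a x x' | x a y y'] /=.
  by rewrite scalerDr !scalerA mulrC.
by rewrite linearP /= scalerDl scalerA.
Qed.

Lemma counitl_bil : bilinear_for *:%R *:%R (fun x y : B => counit x *: y).
Proof.
split=> [y a x x' | x a y y'] /=.
  by rewrite linearP /= scalerDl scalerA.
by rewrite scalerDr !scalerA mulrC.
Qed.

Lemma antipodel_bil (H : hopfType k) :
  bilinear_for *:%R *:%R (fun x y : H => antipode x * y).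
Proof.
split=> [y a x x' | x a y y'] /=.
  by rewrite linearP /= mulrDl scalerAl.
by rewrite mulrDr scalerAr.
Qed.

Lemma antipoder_bil (H : hopfType k) :
  bilinear_for *:%R *:%R (fun x y : H => x * antipode y).
Proof.
split=> [y a x x' | x a y y'] /=.
  by rewrite mulrDl scalerAl.
by rewrite linearP /= mulrDr scalerAr.
Qed.

End Bilinearity.

(* Main.v *)
Require Import Defs.
From HB Require Import structures.
From mathcomp Require Import all_boot all_algebra.
From mathcomp Require Import boolp classical_sets functions.
Set Implicit Arguments.
Unset Strict Implicit.
Unset Printing Implicit Defensive.
Import GRing.Theory.
Local Open Scope classical_set_scope.
Local Open Scope ring_scope.

(** Write Δ(x) = x1 ⊗ x2 and let β : B ⊗ B -> B ⊗ B, x ⊗ y |-> x1 ⊗ x2 y, be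
    the canonical map, a morphism of right B-modules. An antipode amounts to an
    inverse of β, and the theorem holds because the chain condition makes β
    injective on every element that can be divided by β indefinitely.

    If t = Σ x ⊗ y is coinvariant, then β(t) = p_B(t) ⊗ 1, and
    x1 ⊗ y1 ⊗ x2 y2 = x ⊗ y ⊗ 1 yields β(Σ x ⊗ y2 φ(y1)) = Σ x ⊗ φ(y) for every
    linear φ. So t = β^n(u_n) with u_n = Σ x ⊗ y_(n+1) ... y_2 y_1, all u_n lying
    in V ⊗ B for the finite-dimensional span V of the x's. In coordinates, β acts
    on the columns representing the u_n as a fixed square matrix C over B. By a
    theorem of Björk, the descending chain condition on principal left ideals
    implies the one on finitely generated submodules of any left module, here on
    the row spaces of the C^n (principal_dcc_fg_dcc). Hence ker C^n = ker C^(n+1)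
    for some n, and β(t) = 0 forces t = 0 (can_map_tower_trivial). Thus p_B is
    injective on coinvariants (pB_injective).

    The image of p_B is a subalgebra and a left coideal, so K(B) is a
    sub-bialgebra, and so are the K^m(B) and their intersection P
    (Kinfty_subbialg_set). An element b of P has for each m a coinvariant preimage
    under p_B in K^m(B) ⊗ K^m(B); by injectivity all these preimages are the same
    tensor, which therefore lies in P ⊗ P (Kinfty_coinvariant_lift). So p_P is a
    bijection from coinvariants to P. Its inverse has the form b |-> b1 ⊗ S(b2),
    and S : P -> P is a right convolution inverse of the identity
    (right_antipode_exists). It is also a left one: w = S * id - ε satisfies
    id * w = 0 and id * (S * v) = v for every linear v, so the tensors
    b1 ⊗ (S * ... * S * w)(b2) are again an indefinite division by β of
    b1 ⊗ w(b2), which β kills (left_antipode).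

    Conversely, in a Hopf algebra h1 ⊗ S(h2) is coinvariant with image h under
    p_H, so K(H) = H. As K is functorial, a bialgebra map from H to B lands in
    every K^m(B), hence factors through P; the factorization is unique because P
    is embedded in B. *)

(** * Descending chains of finitely generated submodules *)

Section ChainConditions.
Variables (R : pzRingType) (M : lmodType R).

(** No chain of principal left ideals is strict at every step. This is equivalent to
    stabilization, since a chain that does not stabilize has a strict subsequence. *)
Definition principal_dcc : Prop := forall a : nat -> R,
  (forall n, exists b, a n.+1 = b * a n) -> exists n b, a n = b * a n.+1.

Definition submodule (N : set M) : Prop :=
  forall r x y, N x -> N y -> N (r *: x + y).

Fixpoint lspan (s : seq M) : set M :=
  if s is x :: s' then [set v | exists r, lspan s' (v - r *: x)]
  else [set 0].

Definition fg_dcc (N : set M) : Prop := forall L : nat -> set M,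
  (forall n, exists s, L n = lspan s) -> (forall n, L n.+1 `<=` L n) ->
  L 0%N `<=` N -> exists n, L n `<=` L n.+1.

Lemma lspan_submodule s : submodule (lspan s).
Proof.
elim: s => [|x s IHs] r u v /=; first by move=> -> ->; rewrite scaler0 addr0.
move=> [a Ha] [b Hb]; exists (r * a + b).
by have := IHs r _ _ Ha Hb; rewrite scalerBr scalerDl opprD scalerA addrACA.
Qed.

Lemma submodule0 N x : submodule N -> N x -> N 0.
Proof. by move=> sN Nx; have := sN (-1) x x Nx Nx; rewrite scaleN1r addNr. Qed.

Lemma submoduleZ N r x : submodule N -> N x -> N (r *: x).
Proof.
by move=> sN Nx; have := sN r x 0 Nx (submodule0 sN Nx); rewrite addr0.
Qed.

Lemma submoduleD N x y : submodule N -> N x -> N y -> N (x + y).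
Proof. by move=> sN Nx Ny; have := sN 1 x y Nx Ny; rewrite scale1r. Qed.

Lemma submoduleB N x y : submodule N -> N x -> N y -> N (x - y).
Proof.
by move=> sN Nx Ny; rewrite -scaleN1r addrC; apply: sN.
Qed.

Lemma lspan0 s : lspan s 0.
Proof. by elim: s => //= x s IHs; exists 0; rewrite scale0r subr0. Qed.

Lemma lspan_cons x s v : lspan s v -> lspan (x :: s) v.
Proof. by move=> sv /=; exists 0; rewrite scale0r subr0. Qed.

Lemma mem_lspan s x : x \in s -> lspan s x.
Proof.
elim: s => // y s IHs; rewrite inE => /orP[/eqP -> | /IHs]; last exact: lspan_cons.
by exists 1; rewrite scale1r subrr; apply: lspan0.
Qed.

Lemma sub_lspan N s : submodule N -> N 0 -> (forall x, x \in s -> N x) ->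
  lspan s `<=` N.
Proof.
move=> sN N0; elim: s => [|x s IHs] Ns v /= => [-> //|[r]].
move/IHs=> Nv; have {}Nv: N (v - r *: x).
  by apply: Nv => y ys; apply: Ns; rewrite inE ys orbT.
rewrite -[v](subrK (r *: x)); apply: submoduleD => //.
by apply: submoduleZ => //; apply: Ns; rewrite mem_head.
Qed.

(** The cyclic module generated by x is minimal among those not contained in N. *)
Definition minimal_outside (N : set M) (x : M) : Prop :=
  ~ N x /\ forall r, ~ N (r *: x) -> exists s, s *: (r *: x) = x.

(** Otherwise one can choose again and again a multiple outside N generating a
    strictly smaller cyclic module. These multiples are a_n x0 with (a_n) a
    descending chain of principal left ideals, so the chain cannot be strict. *)
Lemma minimal_outside_exists (N E : set M) : principal_dcc ->
    (forall r x, E x -> E (r *: x)) -> ~ (E `<=` N) ->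
  exists2 x, E x & minimal_outside N x.
Proof.
move=> dccR EZ /existsNP[x0 /not_implyP[Ex0 Nx0]]; apply: contrapT => noMin.
have step (x : M) : exists r, E x -> ~ N x ->
    ~ N (r *: x) /\ forall s, s *: (r *: x) <> x.
  have [[Ex Nx]|] := pselect (E x /\ ~ N x); last first.
    by move=> nEN; exists 0 => Ex Nx; case: nEN.
  apply: contrapT => nstep; apply: noMin; exists x => //; split=> // r Nrx.
  apply: contrapT => nos; apply: nstep; exists r => _ _; split=> // s srx.
  by apply: nos; exists s.
have [f fP] := choice step.
pose v := fix v n := if n is n'.+1 then f (v n') *: v n' else x0.
pose a := fix a n := if n is n'.+1 then f (v n') * a n' else 1.
have vE n : v n = a n *: x0.
  by elim: n => [|n IHn] /=; rewrite ?scale1r // {2}IHn scalerA.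
have vP n : E (v n) /\ ~ N (v n).
  elim: n => [//|n [En Nn]] /=; split; first exact: EZ.
  by have [] := fP _ En Nn.
have [|n [b ab]] := dccR a; first by move=> n; exists (f (v n)).
have [En Nn] := vP n; have [_ /(_ b)] := fP _ En Nn; apply.
by rewrite {3}vE ab -scalerA -vE.
Qed.

(** A minimal z in L outside N is r x plus an element of Q; minimality of x lets a
    multiple y of z be congruent to x itself modulo Q. Correcting the generators of
    L by multiples of y then puts them into Q. The submodule Q is N at the start of
    the chain and afterwards the N-part of the preceding term, which makes the
    N-parts descend. *)
Lemma extension_step (N Q L : set M) (x : M) s : principal_dcc ->
    submodule N -> submodule Q -> Q 0 -> Q `<=` N -> minimal_outside N x ->
    L = lspan s -> ~ (L `<=` N) ->
    (forall v, L v -> exists r, Q (v - r *: x)) ->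
  exists y t, [/\ minimal_outside N y, L = lspan (y :: t),
    Q (y - x) & lspan t `<=` Q].
Proof.
move=> dccR sN sQ Q0 QN [Nx xmin] Ls LN LQ.
have sL : submodule L by rewrite Ls; apply: lspan_submodule.
have [z Lz [Nz zmin]] : exists2 z, L z & minimal_outside N z.
  by apply: minimal_outside_exists => // r v; apply: submoduleZ.
have [r Qzx] := LQ z Lz.
have Nrx : ~ N (r *: x).
  by move=> Nrx; apply: Nz; rewrite -[z](subrK (r *: x)); apply: submoduleD => //;
    apply: QN.
have [c crx] := xmin _ Nrx.
pose y := c *: z.
have Qyx : Q (y - x) by rewrite -crx -scalerBr; apply: submoduleZ.
have Ny : ~ N y.
  move=> Ny; apply: Nx; have -> : x = y - (y - x) by rewrite opprB addrC subrK.
  by apply: submoduleB => //; apply: QN.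
have ymin : minimal_outside N y.
  split=> // d; rewrite scalerA => /zmin[e eE]; exists (c * e).
  by rewrite -!scalerA in eE *; rewrite eE.
have Ly : L y by apply: submoduleZ.
have LQy v : L v -> exists r', Q (v - r' *: y).
  move=> /LQ[r' Qv]; exists r'.
  have -> : v - r' *: y = (v - r' *: x) - r' *: (y - x).
    by rewrite scalerBr opprB addrA subrK.
  by apply: submoduleB => //; apply: submoduleZ.
have coef v : exists r', L v -> Q (v - r' *: y).
  by have [/LQy[r' Qv]|nLv] := pselect (L v); [exists r' | exists 0].
have [f fP] := choice coef.
pose t := [seq v - f v *: y | v <- s].
have tP w : w \in t -> Q w /\ L w.
  move=> /mapP[v vs ->]; have Lv : L v by rewrite Ls; apply: mem_lspan.
  split; first exact: fP.
  by apply: submoduleB => //; apply: submoduleZ.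
exists y, t; split=> //; last by apply: sub_lspan => // w /tP[].
apply/seteqP; split; last first.
  apply: sub_lspan => //; first by rewrite Ls; apply: lspan0.
  by move=> w; rewrite inE => /orP[/eqP -> //|/tP[]].
have sT := @lspan_submodule (y :: t).
rewrite {1}Ls; apply: sub_lspan => //; first exact: lspan0.
move=> v vs; rewrite -[v](subrK (f v *: y)); apply: submoduleD => //.
  by apply: lspan_cons; apply: mem_lspan; apply/mapP; exists v.
by apply: submoduleZ => //; apply: mem_lspan; rewrite mem_head.
Qed.

(** Each term of a chain not contained in N is generated by a minimal element and
    finitely many elements of N, chosen by extension_step so that the N-parts form a
    descending chain and consecutive minimal elements differ by an element of the
    earlier N-part. Where the N-parts stall, so does the chain. *)
Lemma fg_dcc_extension (N : set M) (x : M) : principal_dcc ->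
    submodule N -> N 0 -> fg_dcc N -> minimal_outside N x ->
  fg_dcc [set v | exists r, N (v - r *: x)].
Proof.
move=> dccR sN N0 dccN xmin L Lfg Lmono L0.
have [[i LiN]|LN] := pselect (exists i, L i `<=` N).
  have [|||n Ln] := dccN (fun n => L (n + i)%N).
  - by move=> n; apply: Lfg.
  - by move=> n; apply: Lmono.
  - exact: LiN.
  by exists (n + i)%N.
pose good i (st : M * seq M) :=
  [/\ minimal_outside N st.1, L i = lspan (st.1 :: st.2) & lspan st.2 `<=` N].
pose next (st st' : M * seq M) :=
  lspan st.2 (st'.1 - st.1) /\ lspan st'.2 `<=` lspan st.2.
have step i st : exists st', good i st -> good i.+1 st' /\ next st st'.
  have [[ymin LE tN]|ngood] := pselect (good i st); last by exists st.
  have [s Ls] := Lfg i.+1.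
  have [||y [t [y'min L'E Qy tt]]] := @extension_step N (lspan st.2) (L i.+1)
      st.1 s dccR sN (@lspan_submodule _) (lspan0 _) tN ymin Ls.
  - by move=> LN'; apply: LN; exists i.+1.
  - by move=> v /Lmono; rewrite LE.
  exists (y, t) => _; split; split=> //=.
  exact: subset_trans tN.
have [st0 good0] : exists st, good 0%N st.
  have [s Ls] := Lfg 0%N.
  have [||y [t [ymin LE _ tN]]] :=
      @extension_step N N (L 0%N) x s dccR sN sN N0 (fun _ h => h) xmin Ls.
  - by move=> LN'; apply: LN; exists 0%N.
  - exact: L0.
  by exists (y, t).
have [f fP] := choice (fun p : nat * (M * seq M) => step p.1 p.2).
pose st := fix st n := if n is n'.+1 then f (n', st n') else st0.
have stP n : good n (st n).
  by elim: n => [//|n IHn]; have [] := fP (n, st n) IHn.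
have stN n : next (st n) (st n.+1) by have [] := fP (n, st n) (stP n).
have [|||n tn] := dccN (fun n => lspan (st n).2).
- by move=> n; exists (st n).2.
- by move=> n; have [] := stN n.
- by have [] := stP 0%N.
exists n; have [_ -> _] := stP n; have [_ -> _] := stP n.+1.
have sub := @lspan_submodule ((st n.+1).1 :: (st n.+1).2).
apply: sub_lspan => //; first exact: lspan0.
move=> w; rewrite inE => /orP[/eqP ->|wt]; last first.
  by apply/lspan_cons/tn/mem_lspan.
have [Qy _] := stN n.
rewrite -[(st n).1](subKr (st n.+1).1); apply: submoduleB => //.
  by apply: mem_lspan; rewrite mem_head.
exact/lspan_cons/tn.
Qed.

(** Björk's theorem. A submodule maximal among those satisfying the condition must
    be everything, since otherwise it could be enlarged by a cyclic module that is
    minimal outside it. *)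
Theorem principal_dcc_fg_dcc : principal_dcc -> fg_dcc setT.
Proof.
move=> dccR.
have [F FP Ftot|N [[sN dccN] Nmax]] :=
    @Zorn_bigcup M (fun N => submodule N /\ fg_dcc N).
  split=> [r x y [X FX Xx] [Y FY Yy]|L Lfg Lmono L0].
    have [XY|YX] := Ftot _ _ FX FY; [exists Y => // | exists X => //].
      by apply: (FP Y FY).1 => //; apply: XY.
    by apply: (FP X FX).1 => //; apply: YX.
  have [s Ls] := Lfg 0%N.
  have [X FX sX] : exists2 X, F X & forall x, x \in 0 :: s -> X x.
    have {L0 Ls}: forall x, x \in 0 :: s -> (\bigcup_(X in F) X) x.
      move=> x; rewrite inE => /orP[/eqP ->|xs]; apply: L0; rewrite Ls.
        exact: lspan0.
      exact: mem_lspan.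
    elim: s => [|x s IHs] Fs.
      have [X FX X0] := Fs 0 (mem_head _ _); exists X => // x.
      by rewrite inE => /eqP ->.
    have [|X FX sX] := IHs.
      move=> y; rewrite inE => /orP[y0|ys]; apply: Fs; rewrite !inE ?y0 //.
      by rewrite ys !orbT.
    have [|Y FY Yx] := Fs x; first by rewrite !inE eqxx orbT.
    have [XY|YX] := Ftot _ _ FX FY.
      exists Y => // y; rewrite !inE => /or3P[y0|/eqP -> //|ys]; apply: XY;
      by apply: sX; rewrite !inE ?y0 ?ys ?orbT.
    exists X => // y; rewrite !inE => /or3P[y0|/eqP ->|ys].
    - by apply: sX; rewrite !inE y0.
    - exact: YX.
    - by apply: sX; rewrite !inE ys orbT.
  have [sX' dccX] := FP X FX; apply: dccX => //; rewrite Ls.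
  apply: sub_lspan => //; first by apply: sX; rewrite mem_head.
  by move=> x xs; apply: sX; rewrite inE xs orbT.
have N0 : N 0.
  have [[x Nx]|Ne] := pselect (exists x, N x); first exact: submodule0 sN Nx.
  exfalso; apply: (Nmax [set 0]).
    rewrite /proper; split=> [x Nx|sub0]; first by case: Ne; exists x.
    by apply: Ne; exists 0; apply: sub0.
  split=> [r x y -> ->|L Lfg Lmono L0]; first by rewrite /= scaler0 addr0.
  exists 0%N => x /L0 ->; have [s ->] := Lfg 1%N; exact: lspan0.
apply: contrapT => ndcc.
have [||x _ xmin] := @minimal_outside_exists N setT dccR.
- by [].
- move=> NT; apply: ndcc => L Lfg Lmono _; apply: dccN => // v Lv; exact: NT.
apply: (Nmax [set v | exists r, N (v - r *: x)]).
  split=> [v Nv|sub]; first by exists 0; rewrite scale0r subr0.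
  by apply: xmin.1; apply: sub; exists 1; rewrite scale1r subrr.
split; last exact: fg_dcc_extension.
move=> r u v [a ua] [b vb]; exists (r * a + b).
have -> : r *: u + v - (r * a + b) *: x = r *: (u - a *: x) + (v - b *: x).
  by rewrite scalerBr scalerDl opprD scalerA addrACA.
exact: sN.
Qed.
End ChainConditions.

(** * Multilinear maps on tensor products *)

Section LinearityRules.
Variables (k : fieldType).
Implicit Types U V W X : lmodType k.

Lemma lin_id U : linear (fun x : U => x).
Proof. by []. Qed.

Lemma lin_fun U V W (h : {linear V -> W}) (f : U -> V) :
  linear f -> linear (fun x => h (f x)).
Proof. by move=> fL a x y; rewrite fL linearP. Qed.

Lemma lin_comp U V W (h : V -> W) (f : U -> V) :
  linear h -> linear f -> linear (fun x => h (f x)).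
Proof. by move=> hL fL a x y; rewrite fL hL. Qed.

Lemma lin_purel U V W (f : U -> V) (c : W) :
  linear f -> linear (fun x => f x ⊗ c).
Proof. by move=> fL a x y; rewrite fL (pure_is_bilinear _ _).1. Qed.

Lemma lin_purer U V W (f : U -> W) (c : V) :
  linear f -> linear (fun x => c ⊗ f x).
Proof. by move=> fL a x y; rewrite fL (pure_is_bilinear _ _).2. Qed.

Lemma lin_mull U (A : algType k) (f : U -> A) (c : A) :
  linear f -> linear (fun x => f x * c).
Proof. by move=> fL a x y; rewrite fL mulrDl scalerAl. Qed.

Lemma lin_mulr U (A : algType k) (f : U -> A) (c : A) :
  linear f -> linear (fun x => c * f x).
Proof. by move=> fL a x y; rewrite fL mulrDr scalerAr. Qed.

Lemma lin_scalel U V W (g : {scalar V}) (f : U -> V) (c : W) :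
  linear f -> linear (fun x => g (f x) *: c).
Proof. by move=> fL a x y; rewrite fL linearP scalerDl scalerA. Qed.

Lemma lin_scaler U V (f : U -> V) (c : k) :
  linear f -> linear (fun x => c *: f x).
Proof. by move=> fL a x y; rewrite fL scalerDr !scalerA mulrC. Qed.

Lemma lin_sub U V (f g : U -> V) :
  linear f -> linear g -> linear (fun x => f x - g x).
Proof.
by move=> fL gL a x y; rewrite fL gL scalerBr opprD addrACA.
Qed.

Lemma lin_liftf U V W X (F : U -> V -> W -> X) t :
  (forall p q, linear (fun x => F x p q)) ->
  linear (fun x => tens_lift (F x) t).
Proof.
move=> FL a x y; rewrite -tens_lift_comb; apply: eq_tens_lift => p q.
exact: FL.
Qed.

Lemma lin_liftt U V W X (F : V -> W -> X) (f : U -> V ⊗ W) :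
  bilinear_for *:%R *:%R F -> linear f -> linear (fun x => tens_lift F (f x)).
Proof. by move=> FL fL a x y; rewrite fL tens_lift_is_linear. Qed.

Lemma lin0 U V (f : U -> V) : linear f -> f 0 = 0.
Proof.
by move=> fL; have := fL (-1) 0 0; rewrite scaler0 addr0 scaleN1r addNr.
Qed.

Lemma linD U V (f : U -> V) x y : linear f -> f (x + y) = f x + f y.
Proof. by move=> fL; have := fL 1 x y; rewrite !scale1r. Qed.

Lemma linZ U V (f : U -> V) a x : linear f -> f (a *: x) = a *: f x.
Proof. by move=> fL; have := fL a x 0; rewrite (lin0 fL) !addr0. Qed.

Lemma linB U V (f : U -> V) x y : linear f -> f (x - y) = f x - f y.
Proof. by move=> fL; rewrite -scaleN1r linD // linZ // scaleN1r. Qed.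

Lemma lin_bigsum U V (f : U -> V) I (s : seq I) (F : I -> U) : linear f ->
  f (\sum_(i <- s) F i) = \sum_(i <- s) f (F i).
Proof.
move=> fL; elim: s => [|i s IHs]; first by rewrite !big_nil lin0.
by rewrite !big_cons linD // IHs.
Qed.

End LinearityRules.

(** Proves linearity of a function given by an expression, by recursion on the
    expression. Hypotheses are tried first, so that facts about variables and local
    definitions can be supplied in the context. *)
Ltac lin :=
  try (lazymatch goal with |- GRing.linear_for ?s ?f =>
         change (GRing.linear_for s (fun x => f x)) end);
  cbv beta;
  first [solve [auto] |
  lazymatch goal with
  | |- bilinear_for _ _ _ => split=> ?; lin
  | |- prod _ _ => split; lin
  | |- forall _, _ => move=> ?; lin
  | |- GRing.linear_for _ (fun x => x) => apply: lin_id
  | |- GRing.linear_for _ (fun x => pure _ _) =>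
       first [apply: lin_purel | apply: lin_purer]; lin
  | |- GRing.linear_for _ (fun x => _ * _) =>
       first [apply: lin_mull | apply: lin_mulr]; lin
  | |- GRing.linear_for _ (fun x => _ - _) => apply: lin_sub; lin
  | |- GRing.linear_for _ (fun x => _ *: _) =>
       first [apply: lin_scaler | apply: lin_scalel]; lin
  | |- GRing.linear_for _ (fun x => tens_lift _ _) =>
       first [apply: lin_liftf => ? ? | apply: lin_liftt]; lin
  | |- _ => first [ match goal with H : _ |- _ => exact: H end
                  | exact: linearP
                  | apply: lin_fun; lin
                  | apply: lin_comp; [ assumption | lin ] ]
  end].

Section Lift.
Variables (k : fieldType).
Implicit Types U V W X : lmodType k.

Lemma lift_comp U X V W (h : U -> X) (f : V -> W -> U) t : linear h ->
  h (tens_lift f t) = tens_lift (fun x y => h (f x y)) t.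
Proof. exact: lin_bigsum. Qed.

Lemma lift_id V W (t : V ⊗ W) : tens_lift (@pure k V W) t = t.
Proof. by rewrite [RHS]tensE. Qed.

Lemma lift_lift U V V' W W' (f : V -> W -> U) (g : V' -> W' -> V ⊗ W) t :
  bilinear_for *:%R *:%R f ->
  tens_lift f (tens_lift g t) = tens_lift (fun x y => tens_lift f (g x y)) t.
Proof. by move=> fL; apply: lift_comp; apply: tens_lift_is_linear. Qed.

Lemma lift_map U V W V' W' (f : V -> W -> U)
    (g : {linear V' -> V}) (h : {linear W' -> W}) t :
  bilinear_for *:%R *:%R f ->
  tens_lift f (tens_map g h t) = tens_lift (fun x y => f (g x) (h y)) t.
Proof.
move=> fL; rewrite /tens_map lift_comp; last exact: tens_lift_is_linear.
by apply: eq_tens_lift => x y; rewrite tens_lift_pure.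
Qed.

Lemma lift_exchange U V W V' W' (f : V -> W -> V' -> W' -> U) t t' :
  tens_lift (fun x y => tens_lift (f x y) t') t =
  tens_lift (fun x' y' => tens_lift (fun x y => f x y x' y') t) t'.
Proof. exact: exchange_big. Qed.

(** Carries the proof along so that a function becomes a bundled linear map. *)
Definition linear_of U V (f : U -> V) (fL : linear f) : U -> V := f.
HB.instance Definition _ U V (f : U -> V) (fL : linear f) :=
  GRing.isLinear.Build k U V *:%R (linear_of fL) fL.

Definition scalar_of V (f : V -> k) (fL : scalar f) : V -> k := f.
HB.instance Definition _ V (f : V -> k) (fL : scalar f) :=
  GRing.isLinear.Build k V k *%R (scalar_of fL) fL.

End Lift.

(** * Projections, functionals and contractions *)

Section Functionals.
Variables (k : fieldType).
Implicit Types U V W X : lmodType k.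

(** A submodule maximal among those meeting S trivially is a complement of S, over a
    field; the projection along it is the required map. *)
Lemma projection_exists V (S : set V) : submodule S -> S 0 ->
  exists p : {linear V -> V}, (forall v, S (p v)) /\ (forall v, S v -> p v = v).
Proof.
move=> sS S0.
have [F FP Ftot|H [[sH H0] Hmax]] :=
    @Zorn_bigcup V (fun H => submodule H /\ (forall v, H v -> S v -> v = 0)).
  split=> [r x y [X FX Xx] [Y FY Yy]|v [X FX Xv]]; last exact: (FP X FX).2.
  have [XY|YX] := Ftot _ _ FX FY; [exists Y => // | exists X => //].
    by apply: (FP Y FY).1 => //; apply: XY.
  by apply: (FP X FX).1 => //; apply: YX.
have HH0 : H 0.
  have [[x Hx]|He] := pselect (exists x, H x); first exact: submodule0 sH Hx.
  exfalso; apply: (Hmax [set 0]).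
    rewrite /proper; split=> [x Hx|sub0]; first by case: He; exists x.
    by apply: He; exists 0; apply: sub0.
  by split=> [r x y -> ->|v -> //]; rewrite /= scaler0 addr0.
have dec v : exists s, S s /\ H (v - s).
  apply: contrapT => nodec.
  apply: (Hmax [set w | exists c, H (w - c *: v)]).
    split=> [w Hw|sub]; first by exists 0; rewrite scale0r subr0.
    apply: nodec; exists 0; split=> //; rewrite subr0; apply: sub.
    by exists 1; rewrite scale1r subrr.
  split=> [r x y [a xa] [b yb]|w [c wc] Sw].
    exists (r * a + b).
    have -> : r *: x + y - (r * a + b) *: v = r *: (x - a *: v) + (y - b *: v).
      by rewrite scalerBr scalerDl opprD scalerA addrACA.
    exact: sH.
  have [c0|c0] := eqVneq c 0; first by apply: H0 => //; rewrite c0 scale0r subr0 in wc.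
  case: nodec; exists (c^-1 *: w); split; first exact: submoduleZ.
  have -> : v - c^-1 *: w = (- c^-1) *: (w - c *: v).
    by rewrite scalerBr !scaleNr opprK scalerA mulVf // scale1r addrC.
  exact: submoduleZ.
have [p pP] := choice dec.
have pS v : S (p v) by have [] := pP v.
have pH v : H (v - p v) by have [] := pP v.
have uniq v s : S s -> H (v - s) -> s = p v.
  move=> Ss Hs; apply/eqP; rewrite -subr_eq0; apply/eqP; apply: H0.
    have -> : s - p v = (v - p v) - (v - s) by rewrite opprB [RHS]addrC addrA subrK.
    exact: submoduleB.
  exact: submoduleB.
have pL : linear p.
  move=> a u v; apply/esym/uniq; first exact: sS.
  have -> : a *: u + v - (a *: p u + p v) = a *: (u - p u) + (v - p v).
    by rewrite scalerBr opprD addrACA.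
  exact: sH.
exists (linear_of pL); split=> // v Sv.
by apply/esym/uniq => //; rewrite subrr.
Qed.

Lemma retraction_exists U V (j : {linear U -> V}) : injective j ->
  exists r : {linear V -> U}, cancel j r.
Proof.
move=> jinj.
have [||p [pS pid]] := @projection_exists V (range j).
- by move=> a x y [u _ <-] [v _ <-]; exists (a *: u + v) => //; rewrite linearP.
- by exists 0 => //; rewrite linear0.
have ex v : exists u, j u = p v by have [u _ <-] := pS v; exists u.
have [r rP] := choice ex.
have rL : linear r by move=> a x y; apply: jinj; rewrite rP !linearP !rP.
exists (linear_of rL) => u; apply: jinj; rewrite /linear_of rP pid //.
Qed.

Lemma functional_exists V (v : V) : v <> 0 -> exists g : {scalar V}, g v = 1.
Proof.
move=> v0.
have lineL : linear (fun c : k^o => c *: v).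
  by move=> a x y; rewrite scalerDl scalerA.
have [|r rK] := @retraction_exists k^o V (linear_of lineL).
  move=> c d /eqP; rewrite /linear_of -subr_eq0 -scalerBl scaler_eq0.
  by move=> /orP[|/eqP //]; rewrite subr_eq0 => /eqP.
have rL : scalar r by move=> a x y; rewrite linearP.
by exists (scalar_of rL); rewrite /scalar_of -[v]scale1r; apply: rK.
Qed.

(** The operator Σ e f of finite rank fixes the given vectors. By induction: if it
    moves a further vector v, add (v - P v) ⊗ g(id - P) where g is a functional with
    value 1 at v - P v; this fixes v and vanishes on what was already fixed. *)
Lemma finite_rank_expansion V (s : seq V) :
  exists e : seq (V * {scalar V}), forall v, v \in s ->
    v = \sum_(p <- e) p.2 v *: p.1.
Proof.
elim: s => [|v s [e eP]]; first by exists [::].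
pose P (w : V) := \sum_(p <- e) p.2 w *: p.1.
have PL : linear P.
  move=> a x y; rewrite /P scaler_sumr -big_split; apply: eq_bigr => p _ /=.
  by rewrite linearP scalerDl scalerA.
have [v0|v0] := eqVneq (v - P v) 0.
  exists e => w; rewrite inE => /orP[/eqP ->|/eP //].
  by apply/eqP; rewrite -subr_eq0; apply/eqP.
have [g gv] := functional_exists (elimN eqP v0).
have gL : scalar (fun w => g (w - P w)).
  move=> a x y; rewrite PL.
  have -> : a *: x + y - (a *: P x + P y) = a *: (x - P x) + (y - P y).
    by rewrite scalerBr opprD addrACA.
  by rewrite linearP.
pose h : {scalar V} := scalar_of gL.
have hE w : h w = g (w - P w) by [].
exists ((v - P v, h) :: e) => w.
rewrite inE big_cons -/(P w) /= hE => /orP[/eqP ->|/eP wE].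
  by rewrite gv scale1r subrK.
have -> : w - P w = 0 by rewrite {1}wE subrr.
by rewrite linear0 scale0r add0r.
Qed.

Definition contractl V W (g : {scalar V}) (t : V ⊗ W) : W :=
  tens_lift (fun x y => g x *: y) t.
Definition contractr V W (g : {scalar W}) (t : V ⊗ W) : V :=
  tens_lift (fun x y => g y *: x) t.

Lemma contractl_bil V W (g : {scalar V}) :
  bilinear_for *:%R *:%R (fun x (y : W) => g x *: y).
Proof. lin. Qed.
Lemma contractr_bil V W (g : {scalar W}) :
  bilinear_for *:%R *:%R (fun (x : V) y => g y *: x).
Proof. lin. Qed.

HB.instance Definition _ V W (g : {scalar V}) :=
  GRing.isLinear.Build k (V ⊗ W)%type W _ (@contractl V W g)
    (tens_lift_is_linear (@contractl_bil V W g)).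
HB.instance Definition _ V W (g : {scalar W}) :=
  GRing.isLinear.Build k (V ⊗ W)%type V _ (@contractr V W g)
    (tens_lift_is_linear (@contractr_bil V W g)).

Lemma contractl_pure V W (g : {scalar V}) x (y : W) :
  contractl g (x ⊗ y) = g x *: y.
Proof. exact/tens_lift_pure/contractl_bil. Qed.
Lemma contractr_pure V W (g : {scalar W}) (x : V) y :
  contractr g (x ⊗ y) = g y *: x.
Proof. exact/tens_lift_pure/contractr_bil. Qed.

(** The vectors and functionals do not depend on f, so that one choice of
    coordinates serves all the images of t at the same time. *)
Lemma tens_expandl V W (t : V ⊗ W) : exists e : seq (V * {scalar V}),
  forall X (f : {linear W -> X}),
    tens_map idfun f t = \sum_(p <- e) p.1 ⊗ f (contractl p.2 t).
Proof.
have [e eP] := finite_rank_expansion (unzip1 (tens_repr t)).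
exists e => X f; rewrite /contractl /tens_map.
under [RHS]eq_bigr => p _.
  rewrite lift_comp; last exact: linearP.
  rewrite (@lift_comp _ _ _ _ _ (pure p.1)); last by lin.
  over.
rewrite /tens_lift [RHS]exchange_big; apply: eq_big_seq => q qt /=.
have {1}-> : q.1 = \sum_(p <- e) p.2 q.1 *: p.1 by apply/eP/map_f.
rewrite (lin_bigsum (f := fun x => x ⊗ f q.2)); last by lin.
apply: eq_bigr => p _; rewrite (linZ (f := fun x => x ⊗ f q.2)); last by lin.
by rewrite (linZ (f := fun x => p.1 ⊗ f x)) //; lin.
Qed.

Lemma tens_expandr V W (t : V ⊗ W) : exists e : seq (W * {scalar W}),
  t = \sum_(p <- e) contractr p.2 t ⊗ p.1.
Proof.
have [e eP] := finite_rank_expansion (unzip2 (tens_repr t)).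
exists e; rewrite /contractr.
under [RHS]eq_bigr => p _.
  rewrite (@lift_comp _ _ _ _ _ (fun x => x ⊗ p.1)); last by lin.
  over.
rewrite {1}[t]tensE /tens_lift [RHS]exchange_big; apply: eq_big_seq => q qt /=.
have {1}-> : q.2 = \sum_(p <- e) p.2 q.2 *: p.1 by apply/eP/map_f.
rewrite (lin_bigsum (f := fun x => q.1 ⊗ x)); last by lin.
apply: eq_bigr => p _.
rewrite (linZ (f := fun x => q.1 ⊗ x)); last by lin.
by rewrite (linZ (f := fun x => x ⊗ p.1)) //; lin.
Qed.

Lemma tens_map_id V W (t : V ⊗ W) : tens_map idfun idfun t = t.
Proof. exact: lift_id. Qed.

(** The contractions of t - u are the coefficients of its expansion. *)
Lemma contractl_separate V W (t u : V ⊗ W) :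
  (forall g, contractl g t = contractl g u) -> t = u.
Proof.
move=> tu; apply/eqP; rewrite -subr_eq0; apply/eqP.
have [e eE] := tens_expandl (t - u).
have := eE W idfun; rewrite tens_map_id => ->.
by rewrite big1 // => p _; rewrite linearB /= tu subrr linear0r.
Qed.

Lemma contractr_separate V W (t u : V ⊗ W) :
  (forall g, contractr g t = contractr g u) -> t = u.
Proof.
move=> tu; apply/eqP; rewrite -subr_eq0; apply/eqP.
have [e ->] := tens_expandr (t - u).
by rewrite big1 // => p _; rewrite linearB /= tu subrr linear0l.
Qed.

(** By tens_expandr, t is a sum of contractions of t tensored with vectors of W. *)
Lemma tens_sublP V W (S : set V) (t : V ⊗ W) : submodule S -> S 0 ->
  tens_subl S t <-> forall g, S (contractr g t).
Proof.
move=> sS S0; split=> [[s sV ->] g|St].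
  rewrite linear_sum /=; elim: s sV => [|p s IHs] sV; first by rewrite big_nil.
  rewrite big_cons; apply: submoduleD => //.
    by rewrite contractr_pure; apply: submoduleZ => //; apply: sV; rewrite mem_head.
  by apply: IHs => q qs; apply: sV; rewrite inE qs orbT.
have [e eE] := tens_expandr t.
exists [seq (contractr p.2 t, p.1) | p <- e].
  move=> q; elim: e {eE} => //= p e IHe; rewrite inE => /orP[/eqP -> |/IHe //].
  exact: St.
by rewrite {1}eE big_map.
Qed.

Lemma contractr_map V W V' W' (f : {linear V -> V'}) (g : {scalar W'})
    (h : {linear W -> W'}) (t : V ⊗ W) :
  contractr g (tens_map f h t) = f (tens_lift (fun x y => g (h y) *: x) t).
Proof.
rewrite /contractr lift_map; last by lin.
rewrite lift_comp; last by lin.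
by apply: eq_tens_lift => x y; rewrite linearZ.
Qed.

Lemma contractl_map V W V' W' (f : {linear V -> V'}) (g : {scalar V'})
    (h : {linear W -> W'}) (t : V ⊗ W) :
  contractl g (tens_map f h t) = h (tens_lift (fun x y => g (f x) *: y) t).
Proof.
rewrite /contractl lift_map; last by lin.
rewrite lift_comp; last by lin.
by apply: eq_tens_lift => x y; rewrite linearZ.
Qed.

Lemma tens_map_comp U V W U' V' W' (f : {linear V -> W}) (g : {linear U -> V})
    (f' : {linear V' -> W'}) (g' : {linear U' -> V'}) t :
  tens_map f f' (tens_map g g' t) = tens_map (f \o g) (f' \o g') t.
Proof. by rewrite {1}/tens_map lift_map //; lin. Qed.

Lemma tens_map_inj V W V' W' (f : {linear V -> V'}) (g : {linear W -> W'}) :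
  injective f -> injective g -> injective (tens_map f g).
Proof.
move=> /retraction_exists[r rK] /retraction_exists[r' r'K].
apply: (can_inj (g := tens_map r r')) => t.
rewrite tens_map_comp -[RHS]lift_id; apply: eq_tens_lift => x y /=.
by rewrite rK r'K.
Qed.

(** With q a projection onto the image S of j, the hypotheses say that q ⊗ id and
    id ⊗ q both fix t; so q ⊗ q does. This is (S ⊗ V) ∩ (V ⊗ S) = S ⊗ S. *)
Lemma tens_map_range V W (j : {linear W -> V}) (t : V ⊗ V) :
  injective j -> (forall g, range j (contractl g t)) ->
  (forall g, range j (contractr g t)) -> exists u, tens_map j j u = t.
Proof.
move=> /retraction_exists[r rK] tl tr; exists (tens_map r r t).
have jrK v : range j v -> j (r v) = v by move=> [w _ <-]; rewrite rK.
have fixr : tens_map idfun (j \o r) t = t.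
  by apply: contractl_separate => g; rewrite contractl_map; apply/jrK/tl.
have fixl : tens_map (j \o r) idfun t = t.
  by apply: contractr_separate => g; rewrite contractr_map; apply/jrK/tr.
by rewrite tens_map_comp -{2}fixl -{2}fixr tens_map_comp.
Qed.

End Functionals.

(** * Coassociativity, counit and multiplicativity for induced maps *)

Section Sweedler.
Variables (k : fieldType) (B : bialgType k).
Implicit Types U V W : lmodType k.

(** Coassociativity pushed forward along the linear map induced by F: this is what
    makes the notation F(b1, b2, b3) meaningful. *)
Lemma coassoc_lift U (F : B -> B -> B -> U) (b : B) :
    (forall y z, linear (fun x => F x y z)) * (forall x, bilinear_for *:%R *:%R (F x)) ->
  tens_lift (fun x y => tens_lift (fun x1 x2 => F x1 x2 y) (comul x)) (comul b) =
  tens_lift (fun x y => tens_lift (F x) (comul y)) (comul b).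
Proof.
move=> [F1 F23].
have F2 x z : linear (fun y => F x y z) := (F23 x).1 z.
have F3 x y : linear (F x y) := (F23 x).2 y.
pose G (t : B ⊗ (B ⊗ B)) := tens_lift (fun x t => tens_lift (F x) t) t.
have Gbil : bilinear_for *:%R *:%R (fun x t => tens_lift (F x) t).
  split=> [t|x]; first by apply: lin_liftf.
  exact: tens_lift_is_linear.
have := congr1 G (comulA b); rewrite /G [in RHS]lift_map // => <-.
rewrite /tens_assoc lift_lift //.
rewrite [RHS]lift_map; last by lin.
apply: eq_tens_lift => x y; rewrite lift_lift //.
by apply: eq_tens_lift => x1 x2; rewrite !tens_lift_pure.
Qed.

Lemma counitl_lift U (F : B -> U) (b : B) : linear F ->
  tens_lift (fun x y => counit x *: F y) (comul b) = F b.
Proof.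
move=> FL; rewrite -[in RHS](counitl b) lift_comp //.
by apply: eq_tens_lift => x y; rewrite linZ.
Qed.

Lemma counitr_lift U (F : B -> U) (b : B) : linear F ->
  tens_lift (fun x y => counit y *: F x) (comul b) = F b.
Proof.
move=> FL; rewrite -[in RHS](counitr b) lift_comp //.
by apply: eq_tens_lift => x y; rewrite linZ.
Qed.

Lemma comul1 : comul (1 : B) = 1 ⊗ 1.
Proof. exact: (@comul_monoid_morphism k B).1. Qed.

Lemma counit1 : counit (1 : B) = 1.
Proof. exact: (@counit_monoid_morphism k B).1. Qed.

Lemma counitM (x y : B) : counit (x * y) = counit x * counit y.
Proof. exact: (@counit_monoid_morphism k B).2. Qed.

Lemma comulM_lift U (F : B -> B -> U) (x y : B) : bilinear_for *:%R *:%R F ->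
  tens_lift F (comul (x * y)) = tens_lift (fun x1 x2 =>
    tens_lift (fun y1 y2 => F (x1 * y1) (x2 * y2)) (comul y)) (comul x).
Proof.
move=> FL; rewrite (@comul_monoid_morphism k B).2.
rewrite [_ * _]/(mul_tens _ _) /mul_tens lift_lift //.
apply: eq_tens_lift => x1 x2; rewrite lift_lift //.
by apply: eq_tens_lift => y1 y2; rewrite tens_lift_pure.
Qed.

End Sweedler.

(** * The canonical map *)

Section CanonicalMap.
Variables (k : fieldType) (B : bialgType k).
Implicit Types W : lmodType k.

(** The canonical, or Galois, map β of B, invertible when B has an antipode. *)
Definition can_map (t : B ⊗ B) : B ⊗ B :=
  tens_lift (fun x y => tens_lift (fun x1 x2 => x1 ⊗ (x2 * y)) (comul x)) t.

Lemma can_map_bil : bilinear_for *:%R *:%R (fun x y : B =>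
  tens_lift (fun x1 x2 : B => x1 ⊗ (x2 * y)) (comul x)).
Proof. lin. Qed.

HB.instance Definition _ := GRing.isLinear.Build k (B ⊗ B)%type (B ⊗ B)%type _
  can_map (tens_lift_is_linear can_map_bil).

Lemma can_map_pure x y :
  can_map (x ⊗ y) = tens_lift (fun x1 x2 : B => x1 ⊗ (x2 * y)) (comul x).
Proof. exact/tens_lift_pure/can_map_bil. Qed.

Lemma can_map_comp W (f : {linear W -> B}) (t : B ⊗ W) :
  can_map (tens_map idfun f t) = tens_lift (fun x w =>
    tens_lift (fun x1 x2 => x1 ⊗ (x2 * f w)) (comul x)) t.
Proof. exact/lift_map/can_map_bil. Qed.

Lemma contractl_can_map (g : {scalar B}) x y :
  contractl g (can_map (x ⊗ y)) = contractl g (comul x) * y.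
Proof.
rewrite can_map_pure lift_comp; last exact: linearP.
rewrite /contractl (@lift_comp _ _ _ _ _ (fun z => z * y)); last by lin.
apply: eq_tens_lift => x1 x2.
by rewrite (tens_lift_pure (contractl_bil _ g)) scalerAl.
Qed.

Lemma right_perfect_principal_dcc : right_perfect B -> principal_dcc B.
Proof.
move=> hB a aP; have [n|N /(_ N.+1 (leqnSn N)) aN] := hB a.
  by have [b ab] := aP n; move=> _ [c _ <-]; exists (c * b) => //; rewrite ab mulrA.
have : range (fun b => b * a N) (a N) by exists 1 => //; rewrite mul1r.
by rewrite -aN => -[b _ bE]; exists N, b.
Qed.

(** The tensors u_m = (id ⊗ phi m) t satisfy β(u_(m+1)) = u_m and β(u_0) = 0. They
    have coordinates g i m with g i m = Σ_j c i j * g j (m+1), so the columns g(m)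
    satisfy C g(m+1) = g(m) and C g(0) = 0 for one square matrix C over B. The chain
    condition applied to the row spaces of the powers of C gives g(0) = 0. *)
Lemma can_map_tower_trivial W (t : B ⊗ W) (phi : nat -> {linear W -> B}) :
    principal_dcc B ->
    (forall n, can_map (tens_map idfun (phi n.+1) t) = tens_map idfun (phi n) t) ->
    can_map (tens_map idfun (phi 0%N) t) = 0 ->
  tens_map idfun (phi 0%N) t = 0.
Proof.
move=> dccB phiS phi0; have [e eE] := tens_expandl t.
pose r := size e; pose x (i : 'I_r) := (tnth (in_tuple e) i).1.
pose f (i : 'I_r) := (tnth (in_tuple e) i).2.
pose g i m := phi m (contractl (f i) t).
have uE m : tens_map idfun (phi m) t = \sum_i x i ⊗ g i m by rewrite eE big_tnth.
pose c i j := contractl (f i) (comul (x j)).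
have canE i m : contractl (f i) (can_map (tens_map idfun (phi m) t)) =
    \sum_j c i j * g j m.
  rewrite uE (lin_bigsum (f := fun u => contractl (f i) (can_map u))); last by lin.
  by apply: eq_bigr => j _; rewrite contractl_can_map.
have gE i m : g i m = contractl (f i) (tens_map idfun (phi m) t).
  by rewrite contractl_map.
(* Q n i is the i-th coordinate of β^n(u_m) as a function of m; in the left
   B-module of sequences the recurrence reads Q n.+1 = C Q n, so the spans of the
   Q n descend. *)
pose Q n i : (nat -> B^o)%type := fun m => if (n <= m)%N then g i (m - n)%N else 0.
have QS n i : Q n.+1 i = \sum_j (c i j : B) *: Q n j.
  apply/funext => m; rewrite fct_sumE /Q.
  have -> : \sum_j ((c i j : B) *: Q n j) m = \sum_j c i j * Q n j m by [].
  rewrite /Q; case: ltngtP => nm.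
  - rewrite gE -phiS canE; apply: eq_bigr => j _.
    by rewrite subnS prednK // subn_gt0.
  - by rewrite big1 // => j _; rewrite mulr0.
  - by rewrite -nm subnn -canE phi0 linear0.
pose L n := lspan [seq Q n i | i <- enum 'I_r].
have QL n i : L n (Q n i) by apply/mem_lspan/map_f; rewrite mem_enum.
have [|||n Ln] := principal_dcc_fg_dcc dccB (L := L).
- by move=> n; exists [seq Q n i | i <- enum 'I_r].
- move=> n; apply: sub_lspan; [exact: lspan_submodule | exact: lspan0|].
  move=> _ /mapP[i _ ->]; rewrite QS.
  elim/big_rec: _ => [|j v _ Lv]; first exact: lspan0.
  by apply: lspan_submodule => //; apply: QL.
- by [].
(* β^(n+1) annihilates u_n, while β^n(u_n) = u_0 *)
have L0 : L n.+1 `<=` [set v | v n = 0].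
  apply: sub_lspan => //.
    move=> a u v un vn; change (a * u n + v n = 0); rewrite un vn.
    by rewrite mulr0 add0r.
  by move=> _ /mapP[i _ ->]; rewrite /Q /= ltnn.
rewrite uE big1 // => i _.
have := L0 _ (Ln _ (QL n i)); rewrite /Q /= leqnn subnn => ->.
exact: linear0r.
Qed.

End CanonicalMap.

(** * Injectivity of the projection on coinvariants *)

Section Coinvariants.
Variables (k : fieldType) (B : bialgType k).

Lemma coaction_linear : linear (@coaction k B).
Proof. exact: tens_lift_is_linear (coaction_bil B). Qed.

Lemma pB_linear : linear (@pB k B).
Proof. exact: tens_lift_is_linear (pB_bil B). Qed.

(** The identity x1 ⊗ y1 ⊗ x2 y2 = x ⊗ y ⊗ 1 transported along the linear map
    induced by F. *)
Lemma coinvariants_lift (U : lmodType k) (F : B -> B -> B -> U) (t : B ⊗ B) :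
    (forall y z, linear (fun x => F x y z)) * (forall x, bilinear_for *:%R *:%R (F x)) ->
    coinvariants B t ->
  tens_lift (fun x y => tens_lift (fun x1 x2 =>
    tens_lift (fun y1 y2 => F x1 y1 (x2 * y2)) (comul y)) (comul x)) t =
  tens_lift (fun x y => F x y 1) t.
Proof.
move=> [F1 F23].
have F2 x z : linear (fun y => F x y z) := (F23 x).1 z.
have F3 x y : linear (F x y) := (F23 x).2 y.
pose G (u : B ⊗ B ⊗ B) := tens_lift (fun v z => tens_lift (fun x y => F x y z) v) u.
have Gbil : bilinear_for *:%R *:%R
    (fun v z => tens_lift (fun x y => F x y z) v) by lin.
move=> /(congr1 G); rewrite /G tens_lift_pure // => <-.
rewrite /coaction lift_lift //; apply: eq_tens_lift => x y.
rewrite lift_lift //; apply: eq_tens_lift => x1 x2.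
rewrite lift_lift //; apply: eq_tens_lift => y1 y2.
by rewrite !tens_lift_pure //; lin.
Qed.

(** y |-> y_(n+1) ... y_2 y_1, with the factors in the order opposite to that of the
    coproduct: so the product x2 y_(n+1) of coinvariance forms at the left end. *)
Fixpoint copow (n : nat) (y : B) : B :=
  if n is n'.+1 then tens_lift (fun y1 y2 => y2 * copow n' y1) (comul y) else y.

Lemma copow_linear n : linear (copow n).
Proof. by elim: n => [|n IHn] //=; lin. Qed.

Lemma can_map_coinvariants t : coinvariants B t -> can_map t = pB t ⊗ 1.
Proof.
move=> tco.
have := @coinvariants_lift _ (fun x y z => counit y *: (x ⊗ z)) t _ tco.
rewrite /pB (@lift_comp _ _ _ _ _ (fun x => x ⊗ 1)); last by lin.
move=> H; rewrite -[RHS](_ : tens_lift (fun x y => counit y *: (x ⊗ 1)) t = _); last first.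
  by apply: eq_tens_lift => x y; rewrite (linZ (f := fun x => x ⊗ 1)) //; lin.
rewrite -H; last by lin.
apply: eq_tens_lift => x y; apply: eq_tens_lift => x1 x2.
by rewrite -(@counitl_lift _ _ _ (fun y => x1 ⊗ (x2 * y))) //; lin.
Qed.

(** Coinvariance applied to x ⊗ y ⊗ z |-> x ⊗ z φ(y). *)
Lemma can_map_copow n t : coinvariants B t ->
  can_map (tens_map idfun (linear_of (copow_linear n.+1)) t) =
  tens_map idfun (linear_of (copow_linear n)) t.
Proof.
move=> tco; have cL := copow_linear n.
rewrite can_map_comp.
have := @coinvariants_lift _ (fun x y z => x ⊗ (z * copow n y)) t _ tco.
rewrite /tens_map /linear_of /= => H.
rewrite -[RHS](_ : tens_lift (fun x y => x ⊗ (1 * copow n y)) t = _); last first.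
  by apply: eq_tens_lift => x y; rewrite mul1r.
rewrite -H; last by lin.
apply: eq_tens_lift => x y; apply: eq_tens_lift => x1 x2.
rewrite (@lift_comp _ _ _ _ _ (fun z => x1 ⊗ (x2 * z))); last by lin.
by apply: eq_tens_lift => y1 y2; rewrite mulrA.
Qed.

(** A coinvariant d with p_B(d) = 0 satisfies β(d) = 0 and is divided by β
    indefinitely by the tensors built from copow. *)
Theorem pB_injective t u : right_perfect B -> coinvariants B t ->
  coinvariants B u -> pB t = pB u -> t = u.
Proof.
move=> /right_perfect_principal_dcc dccB tco uco tu.
have coL := coaction_linear; have pL := pB_linear.
have dco : coinvariants B (t - u).
  rewrite /coinvariants /= linB // tco uco.
  by rewrite (linB (f := fun v => v ⊗ 1)) //; lin.
have id0 v : tens_map idfun (linear_of (copow_linear 0)) v = v.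
  exact: tens_map_id.
apply/eqP; rewrite -subr_eq0 -[t - u]id0; apply/eqP.
apply: (can_map_tower_trivial (phi := fun n => linear_of (copow_linear n))) => //.
  by move=> n; apply: can_map_copow.
by rewrite id0 can_map_coinvariants // linB // tu subrr linear0l.
Qed.

End Coinvariants.

(** * Sub-bialgebras *)

Section TensorNaturality.
Variable k : fieldType.

Lemma eq_tens_map (V W V' W' : lmodType k) (f f' : V -> V') (g g' : W -> W') t :
  f =1 f' -> g =1 g' -> tens_map f g t = tens_map f' g' t.
Proof. by move=> ff gg; apply: eq_tens_lift => x y; rewrite ff gg. Qed.

Lemma tens_assoc_map (U V W U' V' W' : lmodType k) (f : {linear U -> U'})
    (g : {linear V -> V'}) (h : {linear W -> W'}) t :
  tens_map f (tens_map g h) (tens_assoc t) =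
  tens_assoc (tens_map (tens_map f g) h t).
Proof.
apply: (tens_ext (f := fun t => tens_map f (tens_map g h) (tens_assoc t))
  (g := fun t => tens_assoc (tens_map (tens_map f g) h t))) => [||u z].
- by lin.
- by lin.
rewrite tens_map_pure.
apply: (tens_ext (f := fun u => tens_map f (tens_map g h) (tens_assoc (u ⊗ z)))
  (g := fun u => tens_assoc (tens_map f g u ⊗ h z))) => [||x y].
- by lin.
- by lin.
by rewrite tens_assoc_pure !tens_map_pure /= tens_map_pure tens_assoc_pure.
Qed.

Lemma tens_mapM (A A' B B' : algType k) (f : {lrmorphism A -> B})
    (g : {lrmorphism A' -> B'}) (t u : A ⊗ A') :
  tens_map f g (t * u) = tens_map f g t * tens_map f g u.
Proof.
apply: (tens_ext (f := fun t => tens_map f g (t * u))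
  (g := fun t => tens_map f g t * tens_map f g u)) => [||x y].
- move=> a v w; rewrite [_ * u]mul_tens_linearl linearP.
  by congr (_ + _).
- move=> a v w; rewrite linearP /= [LHS]mul_tens_linearl.
  by congr (_ + _).
apply: (tens_ext (f := fun u => tens_map f g ((x ⊗ y) * u))
  (g := fun u => tens_map f g (x ⊗ y) * tens_map f g u)) => [||x' y'].
- move=> a v w; rewrite [(x ⊗ y) * _]mul_tens_linearr linearP.
  by congr (_ + _).
- move=> a v w; rewrite linearP /= [LHS]mul_tens_linearr.
  by congr (_ + _).
rewrite [_ * (x' ⊗ y')]mul_tens_pure !tens_map_pure [RHS]mul_tens_pure.
by rewrite !rmorphM.
Qed.

End TensorNaturality.

Section SubBialgebra.
Variables (k : fieldType) (B : bialgType k).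

(** Stability under comultiplication is expressed by contractions: Δ(b) lies in
    (B ⊗ S) ∩ (S ⊗ B) = S ⊗ S. *)
Record subbialg_set (S : set B) : Prop := SubbialgSet {
  subbialg_submodule : submodule S;
  subbialg1 : S 1;
  subbialgM : forall x y, S x -> S y -> S (x * y);
  subbialg_contractl : forall g b, S b -> S (contractl g (comul b));
  subbialg_contractr : forall g b, S b -> S (contractr g (comul b));
}.

Definition in_subset (S : set B) : pred B := fun b => `[< S b >].

Lemma in_subsetP S b : reflect (S b) (b \in in_subset S).
Proof. exact: asboolP. Qed.

Record sub_carrier (S : set B) :=
  SubCarrier { sub_val : B; _ : in_subset S sub_val }.

Section Carrier.
Variables (S : set B) (hS : subbialg_set S).

(** The closure hypothesis is a parameter of the type, so that the algebra and
    bialgebra structures depending on it can be attached to the type. *)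
Definition sub_bialg (_ : subbialg_set S) : Type := sub_carrier S.

HB.instance Definition _ := [isSub for @sub_val S].
HB.instance Definition _ := [Choice of sub_carrier S by <:].
HB.instance Definition _ := SubChoice.copy (sub_bialg hS) (sub_carrier S).

Lemma in_subset_subsemialg_closed : GRing.subsemialg_closed (in_subset S).
Proof.
have [sS S1 SM _ _] := hS.
split; first exact/in_subsetP.
- split; first exact/in_subsetP/(submodule0 sS S1).
  by move=> x y /in_subsetP Sx /in_subsetP Sy; apply/in_subsetP; apply: submoduleD.
- by move=> a x /in_subsetP Sx; apply/in_subsetP; apply: submoduleZ.
- by move=> x y /in_subsetP Sx /in_subsetP Sy; apply/in_subsetP; apply: SM.
Qed.

HB.instance Definition _ := GRing.SubChoice_isSubAlgebra.Build k B (in_subset S)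
  (sub_bialg hS) in_subset_subsemialg_closed.

Definition sub_incl : sub_bialg hS -> B := val.

Lemma sub_incl_is_linear : linear sub_incl.
Proof. by []. Qed.

Lemma sub_incl_is_monoid_morphism : monoid_morphism sub_incl.
Proof. by []. Qed.

HB.instance Definition _ := GRing.isLinear.Build k (sub_bialg hS) B *:%R
  sub_incl sub_incl_is_linear.
HB.instance Definition _ := GRing.isMonoidMorphism.Build (sub_bialg hS) B
  sub_incl sub_incl_is_monoid_morphism.

Lemma sub_incl_inj : injective sub_incl.
Proof. exact: val_inj. Qed.

Lemma sub_incl_range : range sub_incl = S.
Proof.
apply/seteqP; split=> [_ [a _ <-]|b Sb]; first exact/asboolP/(valP a).
have Sb' : in_subset S b by apply/asboolP.
by exists (SubCarrier Sb').
Qed.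

(** Δ maps S into S ⊗ S, and S ⊗ S embeds in B ⊗ B; all the axioms of a bialgebra
    are then inherited through the embedding. *)
Lemma comul_restricts :
  exists D : {linear sub_bialg hS -> (sub_bialg hS ⊗ sub_bialg hS)%type},
    forall a, tens_map sub_incl sub_incl (D a) = comul (sub_incl a).
Proof.
have ex a : exists t, tens_map sub_incl sub_incl t = comul (sub_incl a).
  have Sa : S (sub_incl a) by rewrite -sub_incl_range; exists a.
  apply: tens_map_range => [|g|g]; first exact: sub_incl_inj.
  - by rewrite sub_incl_range; apply: subbialg_contractl.
  - by rewrite sub_incl_range; apply: subbialg_contractr.
have [D DP] := choice ex.
have DL : linear D.
  move=> c a b; apply: (tens_map_inj sub_incl_inj sub_incl_inj).
  by rewrite linearP /= !DP !linearP.
by exists (linear_of DL).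
Qed.

Definition sub_comul : {linear sub_bialg hS -> (sub_bialg hS ⊗ sub_bialg hS)%type} :=
  sval (cid comul_restricts).

Lemma sub_comulE a : tens_map sub_incl sub_incl (sub_comul a) = comul (sub_incl a).
Proof. exact: (svalP (cid comul_restricts)). Qed.

Definition sub_counit : {scalar sub_bialg hS} := 
  counit \o sub_incl.

Lemma sub_comulA a : tens_assoc (tens_map sub_comul idfun (sub_comul a)) =
  tens_map idfun sub_comul (sub_comul a).
Proof.
apply: (tens_map_inj sub_incl_inj (tens_map_inj sub_incl_inj sub_incl_inj)).
rewrite tens_assoc_map !tens_map_comp.
rewrite (@eq_tens_map _ _ _ _ _ _ (comul \o sub_incl) _ (idfun \o sub_incl));
  [ | exact: sub_comulE | by []].
rewrite [RHS](@eq_tens_map _ _ _ _ _ _ (idfun \o sub_incl) _ (comul \o sub_incl));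
  [ | by [] | exact: sub_comulE].
by rewrite -!tens_map_comp sub_comulE comulA.
Qed.

Lemma sub_counitl a : tens_lift (fun x y => sub_counit x *: y) (sub_comul a) = a.
Proof.
apply: sub_incl_inj; rewrite -[RHS]counitl -sub_comulE lift_map; last by lin.
rewrite lift_comp; last by lin.
by apply: eq_tens_lift => x y; rewrite linearZ.
Qed.

Lemma sub_counitr a : tens_lift (fun x y => sub_counit y *: x) (sub_comul a) = a.
Proof.
apply: sub_incl_inj; rewrite -[RHS]counitr -sub_comulE lift_map; last by lin.
rewrite lift_comp; last by lin.
by apply: eq_tens_lift => x y; rewrite linearZ.
Qed.

Lemma sub_comul_monoid : monoid_morphism sub_comul.
Proof.
split=> [|a b]; apply: (tens_map_inj sub_incl_inj sub_incl_inj).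
  by rewrite sub_comulE rmorph1 comul1 tens_map_pure rmorph1.
rewrite tens_mapM !sub_comulE rmorphM.
exact: (@comul_monoid_morphism k B).2.
Qed.

Lemma sub_counit_monoid : monoid_morphism sub_counit.
Proof.
split=> [|a b]; rewrite /sub_counit /=; first by rewrite rmorph1 counit1.
by rewrite rmorphM counitM.
Qed.

HB.instance Definition _ := isBialgebra.Build k (sub_bialg hS) sub_comulA
  sub_counitl sub_counitr sub_comul_monoid sub_counit_monoid.

End Carrier.

Lemma subbialg_exists (S : set B) : subbialg_set S ->
  exists (A : bialgType k) (j : {lrmorphism A -> B}), subbialg j S.
Proof.
move=> hS; exists (sub_bialg hS), (sub_incl (hS := hS)).
split; [|exact: sub_incl_inj|exact: sub_incl_range].
by split=> a; [rewrite -sub_comulE|].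
Qed.

End SubBialgebra.

(** * The image of the projection and the sub-bialgebra K *)

Section KSubBialgebra.
Variables (k : fieldType) (B : bialgType k).

Lemma coinvariants_submodule : submodule (coinvariants B).
Proof.
move=> a t u tco uco; rewrite /coinvariants /= coaction_linear tco uco.
by rewrite (pure_is_bilinear _ _).1.
Qed.

Lemma im_pB_submodule : submodule (im_pB B).
Proof.
move=> a _ _ [t tco <-] [u uco <-]; exists (a *: t + u).
  exact: coinvariants_submodule.
exact: pB_linear.
Qed.

Lemma coaction_pure x y : coaction (x ⊗ y) = tens_lift (fun x1 x2 =>
  tens_lift (fun y1 y2 : B => (x1 ⊗ y1) ⊗ (x2 * y2)) (comul y)) (comul x).
Proof. exact: tens_lift_pure (coaction_bil B) _ _. Qed.

Lemma pB_pure x y : pB (x ⊗ y) = counit y *: (x : B).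
Proof. exact: tens_lift_pure (pB_bil B) _ _. Qed.

Lemma coinvariants1 : coinvariants B (1 ⊗ 1).
Proof.
rewrite /coinvariants /= coaction_pure comul1.
by rewrite !tens_lift_pure ?mulr1 //; lin.
Qed.

Lemma im_pB1 : im_pB B 1.
Proof.
exists (1 ⊗ 1); first exact: coinvariants1.
by rewrite pB_pure counit1 scale1r.
Qed.

(** The product of B ⊗ B with the opposite multiplication on the second factor. *)
Definition op_mul_tens (t u : B ⊗ B) : B ⊗ B :=
  tens_lift (fun x y => tens_lift (fun x' y' => (x * x') ⊗ (y' * y)) u) t.

(** The coaction sends (x ⊗ y)(x' ⊗ y') to
    x1 x1' ⊗ y1' y1 ⊗ x2 (x2' y2') y2; coinvariance of u removes x2' y2', and then
    that of t removes x2 y2. This is why the second factors are multiplied in the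
    opposite order. *)
Lemma coinvariants_op_mul t u : coinvariants B t -> coinvariants B u ->
  coinvariants B (op_mul_tens t u).
Proof.
have cL := @coaction_linear k B.
move=> tco uco; rewrite /coinvariants /= /op_mul_tens lift_comp //.
rewrite (@lift_comp _ _ _ _ _ (fun v => v ⊗ 1)); last by lin.
pose F x y z : (B ⊗ B) ⊗ B := tens_lift (fun x' y' => ((x * x') ⊗ (y' * y)) ⊗ z) u.
rewrite -[RHS](_ : tens_lift (fun x y => F x y 1) t = _); last first.
  by apply: eq_tens_lift => x y; rewrite (@lift_comp _ _ _ _ _ (fun v => v ⊗ 1)) //; lin.
rewrite -coinvariants_lift //; last by rewrite /F; lin.
apply: eq_tens_lift => x y.
transitivity (tens_lift (fun x' y' =>
  tens_lift (fun x1 x2 => tens_lift (fun x1' x2' =>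
  tens_lift (fun y1' y2' => tens_lift (fun y1 y2 =>
    ((x1 * x1') ⊗ (y1' * y1)) ⊗ ((x2 * x2') * (y2' * y2)))
  (comul y)) (comul y')) (comul x')) (comul x)) u).
  rewrite lift_comp //; apply: eq_tens_lift => x' y'.
  rewrite coaction_pure comulM_lift; last by lin.
  apply: eq_tens_lift => x1 x2; apply: eq_tens_lift => x1' x2'.
  by rewrite comulM_lift //; lin.
rewrite lift_exchange; apply: eq_tens_lift => x1 x2.
transitivity (tens_lift (fun y1 y2 => tens_lift (fun x' y' =>
  tens_lift (fun x1' x2' => tens_lift (fun y1' y2' => 
    ((x1 * x1') ⊗ (y1' * y1)) ⊗ (x2 * (x2' * y2') * y2))
  (comul y')) (comul x')) u) (comul y)).
  rewrite [RHS]lift_exchange; apply: eq_tens_lift => x' y'.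
  rewrite [RHS]lift_exchange; apply: eq_tens_lift => x1' x2'.
  rewrite [RHS]lift_exchange; apply: eq_tens_lift => y1' y2'.
  by apply: eq_tens_lift => y1 y2; rewrite !mulrA.
apply: eq_tens_lift => y1 y2; rewrite /F.
have := @coinvariants_lift _ _ _
  (fun a b c => ((x1 * a) ⊗ (b * y1)) ⊗ (x2 * c * y2)) u _ uco.
by move=> ->; [apply: eq_tens_lift => x' y'; rewrite mulr1 | lin].
Qed.

Lemma pB_op_mul t u : pB (op_mul_tens t u) = pB t * pB u.
Proof.
have pL := @pB_linear k B; rewrite /op_mul_tens lift_comp //.
rewrite [in RHS]/pB (@lift_comp _ _ _ _ _ (fun z => z * pB u)); last by lin.
apply: eq_tens_lift => x y; rewrite lift_comp //.
rewrite [in RHS]/pB (@lift_comp _ _ _ _ _ (fun z => counit y *: x * z)); last by lin.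
apply: eq_tens_lift => x' y'; rewrite pB_pure counitM.
by rewrite -scalerAl -scalerAr scalerA mulrC.
Qed.

Lemma im_pBM x y : im_pB B x -> im_pB B y -> im_pB B (x * y).
Proof.
move=> [t tco <-] [u uco <-]; exists (op_mul_tens t u).
  exact: coinvariants_op_mul.
exact: pB_op_mul.
Qed.

Lemma contractl_lift (U : lmodType k) (F : B -> U) (g : {scalar B}) t : linear F ->
  F (contractl g t) = tens_lift (fun x y => g x *: F y) t.
Proof.
by move=> FL; rewrite lift_comp //; apply: eq_tens_lift => x y; rewrite linZ.
Qed.

(** The left B-comodule structure of B ⊗ B on its first factor, contracted by g. It
    commutes with the coaction, which makes the image of p_B a left coideal. *)
Definition contract_comul (g : {scalar B}) (t : B ⊗ B) : B ⊗ B :=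
  tens_lift (fun x y => contractl g (comul x) ⊗ y) t.

Lemma coinvariants_contract_comul g t : coinvariants B t ->
  coinvariants B (contract_comul g t).
Proof.
have cL := @coaction_linear k B.
move=> tco; rewrite /coinvariants /= /contract_comul lift_comp //.
rewrite (@lift_comp _ _ _ _ _ (fun v => v ⊗ 1)); last by lin.
rewrite -(@coinvariants_lift _ _ _
  (fun x y z => (contractl g (comul x) ⊗ y) ⊗ z)) //; last by lin.
apply: eq_tens_lift => x y.
rewrite coaction_pure.
pose F x1 x2 : (B ⊗ B) ⊗ B :=
  tens_lift (fun y1 y2 => (x1 ⊗ y1) ⊗ (x2 * y2)) (comul y).
have FB : bilinear_for *:%R *:%R F by rewrite /F; lin.
have F1 z : linear (fun x => F x z) := FB.1 z.
have F2 x' : linear (F x') := FB.2 x'.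
rewrite -/F (contractl_lift (F := fun z => tens_lift F (comul z))); last by lin.
under eq_tens_lift => x1 x2.
  rewrite (@lift_comp _ _ _ _ _ (fun v => g x1 *: v)); last by lin.
  over.
rewrite -(@coassoc_lift _ _ _ (fun x1 x2 x3 => g x1 *: F x2 x3)); last by lin.
apply: eq_tens_lift => x1 x2; rewrite /F.
rewrite -(@contractl_lift _ (fun z => tens_lift (fun y1 y2 => (z ⊗ y1) ⊗ (x2 * y2)) (comul y))) //.
by lin.
Qed.

Lemma pB_contract_comul g t : pB (contract_comul g t) = contractl g (comul (pB t)).
Proof.
have pL := @pB_linear k B.
rewrite /contract_comul lift_comp // [in RHS]/pB.
rewrite (@lift_comp _ _ _ _ _ (fun x => contractl g (comul x))); last by lin.
by apply: eq_tens_lift => x y; rewrite pB_pure !linearZ.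
Qed.

Lemma im_pB_contractl g b : im_pB B b -> im_pB B (contractl g (comul b)).
Proof.
move=> [t tco <-]; exists (contract_comul g t).
  exact: coinvariants_contract_comul.
exact: pB_contract_comul.
Qed.

Lemma KP b : K B b <-> forall g, im_pB B (contractr g (comul b)).
Proof. exact/tens_sublP/(submodule0 im_pB_submodule im_pB1)/im_pB_submodule. Qed.

Lemma K_im_pB b : K B b -> im_pB B b.
Proof. by move=> /KP/(_ counit); rewrite /contractr counitr. Qed.

(** The image of p_B is a subalgebra and a left coideal. Elements g(b1) b2 stay in K
    because g(b1) b2 h(b3) lies in the left coideal generated by b1 h(b2); elements
    b1 g(b2) stay in K because b1 h(b2) g(b3) is a contraction of Δ(b) by the
    convolution of h and g. *)
Lemma K_subbialg_set : subbialg_set (K B).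
Proof.
have sI := im_pB_submodule.
split.
- move=> a x y /KP Kx /KP Ky; apply/KP => g.
  have -> : contractr g (comul (a *: x + y)) =
      a *: contractr g (comul x) + contractr g (comul y) by rewrite !linearP.
  exact: sI.
- apply/KP => g; rewrite comul1 contractr_pure.
  exact/(submoduleZ _ sI)/im_pB1.
- move=> x y [s sI1 xE] [s' s'I yE].
  rewrite /K /tens_subl /= (@comul_monoid_morphism k B).2 xE yE.
  exists [seq (p.1 * q.1, p.2 * q.2) | p <- s, q <- s'].
    move=> _ /allpairsP[[p q] [/= ps qs ->]] /=.
    by apply: im_pBM; [apply: sI1 | apply: s'I].
  rewrite mulr_suml big_allpairs_dep /=; apply: eq_bigr => p _.
  rewrite mulr_sumr; apply: eq_bigr => q _.
  exact: mul_tens_pure.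
- move=> g b /KP Kb; apply/KP => h.
  have -> : contractr h (comul (contractl g (comul b))) =
      contractl g (comul (contractr h (comul b))).
    rewrite /contractr (@contractl_lift _ (fun z => tens_lift (fun x y => h y *: x) (comul z))); last by lin.
    under eq_tens_lift => x y.
      rewrite (@lift_comp _ _ _ _ _ (fun v => g x *: v)); last by lin.
      over.
    rewrite -(@coassoc_lift _ _ _ (fun x1 x2 x3 => g x1 *: (h x3 *: x2))); last by lin.
    rewrite (@lift_comp _ _ _ _ _ (fun z => contractl g (comul z))); last by lin.
    apply: eq_tens_lift => x y; rewrite !linearZ /= [in RHS]/contractl.
    rewrite (@lift_comp _ _ _ _ _ (fun v => h y *: v)); last by lin.
    by apply: eq_tens_lift => x1 x2; rewrite !scalerA mulrC.
  exact/im_pB_contractl.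
- move=> g b /KP Kb; apply/KP => h.
  pose gh (x : B) := tens_lift (fun x1 x2 => (h x1 * g x2 : k^o)) (comul x).
  have ghL : scalar gh.
    have L : bilinear_for *:%R *:%R (fun x1 x2 : B => (h x1 * g x2 : k^o)).
      split=> [y a u v|x a u v]; first by rewrite /= linearP mulrDl -mulrA.
      by rewrite /= linearP mulrDr mulrCA.
    by move=> a x y; rewrite /gh linearP tens_lift_is_linear.
  have := Kb (scalar_of ghL); congr (im_pB B _).
  rewrite /contractr; symmetry.
  rewrite (@lift_comp _ _ _ _ _ (fun z => tens_lift (fun x y => h y *: x) (comul z))); last by lin.
  under eq_tens_lift => x y.
    rewrite linearZ /= (linZ (f := tens_lift _)); last exact: tens_lift_is_linear (contractr_bil _ _).
    rewrite (@lift_comp _ _ _ _ _ (fun v => g y *: v)); last by lin.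
    over.
  rewrite (@coassoc_lift _ _ _ (fun x1 x2 x3 => g x3 *: (h x2 *: x1))); last by lin.
  apply: eq_tens_lift => x y; rewrite /scalar_of /gh.
  rewrite /tens_lift scaler_suml; apply: eq_bigr => p _.
  by rewrite scalerA mulrC.
Qed.

End KSubBialgebra.

(** * Functoriality *)

Section Functoriality.
Variables (k : fieldType) (A B : bialgType k) (f : {lrmorphism A -> B}).
Hypothesis fB : bialg_morphism f.

Lemma coaction_map t :
  coaction (tens_map f f t) = tens_map (tens_map f f) f (coaction t).
Proof.
rewrite /coaction lift_map; last exact: coaction_bil.
rewrite lift_comp; last by lin.
apply: eq_tens_lift => x y; rewrite !fB.1 lift_map; last by lin.
rewrite lift_comp; last by lin.
apply: eq_tens_lift => x1 x2; rewrite lift_map; last by lin.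
rewrite lift_comp; last by lin.
by apply: eq_tens_lift => y1 y2; rewrite tens_map_pure /= tens_map_pure rmorphM.
Qed.

Lemma coinvariants_map t : coinvariants A t -> coinvariants B (tens_map f f t).
Proof.
by move=> tco; rewrite /coinvariants /= coaction_map tco tens_map_pure rmorph1.
Qed.

Lemma coinvariants_reflect t : injective f ->
  coinvariants B (tens_map f f t) -> coinvariants A t.
Proof.
move=> finj; rewrite /coinvariants /= coaction_map => tco.
apply: (tens_map_inj (tens_map_inj finj finj) finj).
by rewrite tco tens_map_pure rmorph1.
Qed.

Lemma pB_map t : pB (tens_map f f t) = f (pB t).
Proof.
rewrite /pB lift_map; last by lin.
rewrite lift_comp; last by lin.
by apply: eq_tens_lift => x y; rewrite fB.2 linearZ.
Qed.

Lemma K_map a : K A a -> K B (f a).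
Proof.
move=> [s sI aE]; exists [seq (f p.1, f p.2) | p <- s].
  move=> _ /mapP[p ps ->] /=; have [t tco <-] := sI p ps.
  by exists (tens_map f f t); [apply: coinvariants_map | apply: pB_map].
rewrite fB.1 aE linear_sum big_map.
by apply: eq_bigr => p _; apply: tens_map_pure.
Qed.

Lemma image_subbialg_set S : subbialg_set S -> subbialg_set (f @` S).
Proof.
move=> [sS S1 SM Sl Sr]; split.
- by move=> a _ _ [x Sx <-] [y Sy <-]; exists (a *: x + y); [apply: sS | rewrite linearP].
- by exists 1 => //; rewrite rmorph1.
- by move=> _ _ [x Sx <-] [y Sy <-]; exists (x * y); [apply: SM | rewrite rmorphM].
- move=> g _ [x Sx <-]; have gL : scalar (fun a => g (f a)) by move=> a u v; rewrite !linearP.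
  exists (contractl (scalar_of gL) (comul x)); first exact: Sl.
  by rewrite fB.1 contractl_map.
- move=> g _ [x Sx <-]; have gL : scalar (fun a => g (f a)) by move=> a u v; rewrite !linearP.
  exists (contractr (scalar_of gL) (comul x)); first exact: Sr.
  by rewrite fB.1 contractr_map.
Qed.

End Functoriality.

Section LRMorphismOf.
Variables (k : fieldType) (A B : algType k) (f : A -> B).
Hypotheses (fL : linear f) (fM : monoid_morphism f).

Definition lrmorphism_of of linear f & monoid_morphism f : A -> B := f.
HB.instance Definition _ := GRing.isLinear.Build k A B *:%R
  (lrmorphism_of fL fM) fL.
HB.instance Definition _ := GRing.isMonoidMorphism.Build A B
  (lrmorphism_of fL fM) fM.
End LRMorphismOf.

(** Bialgebra maps corestrict to a sub-bialgebra containing their image, since the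
    structure of a sub-bialgebra is determined by the embedding. *)
Lemma bialg_morphism_factor (k : fieldType) (H A B : bialgType k)
    (f : {lrmorphism H -> B}) (j : {lrmorphism A -> B}) (S : set B) :
    bialg_morphism f -> subbialg j S -> (forall h, S (f h)) ->
  exists2 g : {lrmorphism H -> A}, bialg_morphism g & forall h, j (g h) = f h.
Proof.
move=> fB [jB jinj jS] fS.
have ex h : exists a, j a = f h.
  by have := fS h; rewrite -jS => -[a _ aE]; exists a.
have [g gP] := choice ex.
have gL : linear g by move=> a x y; apply: jinj; rewrite gP !linearP /= !gP.
have gM : monoid_morphism g.
  split=> [|x y]; apply: jinj; first by rewrite gP !rmorph1.
  by rewrite gP !rmorphM /= !gP.
exists (lrmorphism_of gL gM); last exact: gP.
split=> h; last by rewrite -jB.2 [X in counit X]gP fB.2.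
apply: (tens_map_inj jinj jinj); rewrite -jB.1 [X in comul X]gP fB.1 tens_map_comp.
by apply: eq_tens_map => x; rewrite -gP.
Qed.

(** * From bijectivity of the projection to an antipode *)

Section Antipode.
Variable k : fieldType.

(** Let τ invert p_P. It is left colinear, because contract_comul maps coinvariants to
    coinvariants and commutes with p_P. So τ(b) = b1 ⊗ S(b2) with S = (ε ⊗ id) τ, and
    applying ε ⊗ ε ⊗ id to the coinvariance of τ(b) gives b1 S(b2) = ε(b). *)
Lemma right_antipode_exists (P : bialgType k) :
    (forall b : P, im_pB P b) ->
    (forall t u : P ⊗ P, coinvariants P t -> coinvariants P u -> pB t = pB u -> t = u) ->
  exists S : {linear P -> P}, forall b,
    tens_lift (fun x y => x * S y) (comul b) = (counit b)%:A.
Proof.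
move=> surj inj; have pL := @pB_linear _ P.
have ex b : exists t : P ⊗ P, coinvariants P t /\ pB t = b.
  by have [t tco <-] := surj b; exists t.
have [tau tauP] := choice ex.
have tauC b : coinvariants P (tau b) by have [] := tauP b.
have tauK b : pB (tau b) = b by have [] := tauP b.
have tauU t : coinvariants P t -> tau (pB t) = t.
  by move=> tco; apply: inj; rewrite ?tauK.
have tauL : linear tau.
  move=> a x y; apply: inj => //; first exact: coinvariants_submodule.
  by rewrite pL !tauK.
have SL : linear (fun b => contractl counit (tau b)) by lin.
exists (linear_of SL) => b.
have tauE : tens_map idfun (linear_of SL) (comul b) = tau b.
  apply: contractl_separate => g; rewrite contractl_map.
  have -> : tens_lift (fun x y => g (idfun x) *: y) (comul b) =
      pB (contract_comul g (tau b)) by rewrite pB_contract_comul tauK.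
  rewrite [LHS]/(contractl counit (tau _)) tauU; last exact: coinvariants_contract_comul.
  rewrite /contract_comul lift_lift; last by lin.
  apply: eq_tens_lift => x y; rewrite (tens_lift_pure (contractl_bil _ counit)).
  congr (_ *: _).
  rewrite -[in RHS](counitr x) /contractl.
  rewrite (lin_bigsum (f := g : P -> k^o)); last by move=> ? ? ?; rewrite linearP.
  rewrite (lin_bigsum (f := counit : P -> k^o)); last by move=> ? ? ?; rewrite linearP.
  by apply: eq_bigr => p _; rewrite !linearZ /= mulrC.
have -> : tens_lift (fun x y => x * linear_of SL y) (comul b) =
    tens_lift (fun x y => x * y) (tau b).
  by rewrite -tauE lift_map //; lin.
have := @coinvariants_lift _ _ _ (fun x y z : P => counit x *: (counit y *: z))
  (tau b) _ (tauC b).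
move=> H.
transitivity (tens_lift (fun x y : P => counit x *: (counit y *: (1 : P))) (tau b)).
  rewrite -H; last by lin.
  apply: eq_tens_lift => x y.
  transitivity (tens_lift (fun x1 x2 : P => counit x1 *: (x2 * y)) (comul x)).
    by rewrite (@counitl_lift _ _ _ (fun x => x * y)) //; lin.
  apply: eq_tens_lift => x1 x2.
  by rewrite -(@counitl_lift _ _ _ (fun y => counit x1 *: (x2 * y))) //;
    [apply: eq_tens_lift => y1 y2; rewrite !scalerA mulrC | lin].
rewrite -[in RHS](tauK b) /pB (@lift_comp _ _ _ _ _ (fun x : P => (counit x)%:A)); last by lin.
by apply: eq_tens_lift => x y; rewrite [in RHS]linearZ /= scalerA mulrC.
Qed.

Section LeftAntipode.
Variables (P B : bialgType k) (j : {lrmorphism P -> B}) (S : {linear P -> P}).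
Hypotheses (jB : bialg_morphism j) (jinj : injective j).
Hypothesis dccB : principal_dcc B.
Hypothesis SR : forall b, tens_lift (fun x y => x * S y) (comul b) = (counit b)%:A.

(** Associativity of the convolution product, in which S is a right inverse of the
    identity. *)
Lemma right_antipode_cancel (w : P -> P) b : linear w ->
  tens_lift (fun x y => x * tens_lift (fun y1 y2 => S y1 * w y2) (comul y)) (comul b) = w b.
Proof.
move=> wL; rewrite -[RHS](counitl_lift b wL).
under eq_tens_lift => x y.
  rewrite (@lift_comp _ _ _ _ _ (fun z => x * z)); last by lin.
  over.
rewrite -(@coassoc_lift _ _ _ (fun x y z => x * (S y * w z))); last by lin.
apply: eq_tens_lift => x y.
transitivity ((counit x)%:A * w y); last by rewrite -scalerAl mul1r.
rewrite -SR (@lift_comp _ _ _ _ _ (fun z => z * w y)); last by lin.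
by apply: eq_tens_lift => x1 x2; rewrite mulrA.
Qed.

(** The convolution products S * ... * S * (S * id - ε) with n leading factors S. *)
Fixpoint antipode_defect n (b : P) : P :=
  if n is n'.+1
  then tens_lift (fun x y => S x * antipode_defect n' y) (comul b)
  else tens_lift (fun x y => S x * y) (comul b) - (counit b)%:A.

Lemma antipode_defect_linear n : linear (antipode_defect n).
Proof. by elim: n => [|n IHn] /=; lin. Qed.

Lemma antipode_defect0_cancel b :
  tens_lift (fun x y => x * antipode_defect 0 y) (comul b) = 0.
Proof.
transitivity (b - b); last by rewrite subrr.
rewrite -{2}(right_antipode_cancel b (@lin_id _ P)) -{3}(counitr b).
rewrite /tens_lift -sumrB; apply: eq_bigr => p _.
by rewrite /= mulrBr -scalerAr mulr1.
Qed.

Lemma can_map_convolution (w : P -> P) (jwL : linear (fun b => j (w b))) b :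
    linear w ->
  can_map (tens_map idfun (linear_of jwL) (tens_map j idfun (comul b))) =
  tens_lift (fun x y => j x ⊗ j (tens_lift (fun y1 y2 => y1 * w y2) (comul y))) (comul b).
Proof.
move=> wL; rewrite can_map_comp lift_map; last by lin.
under eq_tens_lift => x y.
  rewrite jB.1 lift_map; last by lin.
  over.
rewrite (@coassoc_lift _ _ _ (fun x y z => j x ⊗ (j y * linear_of jwL z))); last by lin.
apply: eq_tens_lift => x y.
rewrite (@lift_comp _ _ _ _ _ (fun z => j x ⊗ j z)); last by lin.
by apply: eq_tens_lift => y1 y2; rewrite rmorphM.
Qed.

(** By right_antipode_cancel the tensors j(b1) ⊗ j((antipode_defect n)(b2)) form a
    tower for β on B ⊗ B ending in one killed by β. The tower lives in B and not in P
    because the chain condition is known for B only. *)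
Lemma left_antipode b : tens_lift (fun x y => S x * y) (comul b) = (counit b)%:A.
Proof.
have dL := antipode_defect_linear.
have jdL n : linear (fun b => j (antipode_defect n b)) by lin.
pose T n := tens_lift (fun x y => j x ⊗ j (antipode_defect n y)) (comul b).
have TE n : tens_map idfun (linear_of (jdL n)) (tens_map j idfun (comul b)) = T n.
  by rewrite tens_map_comp.
have canT n : can_map (T n) = tens_lift (fun x y =>
    j x ⊗ j (tens_lift (fun y1 y2 => y1 * antipode_defect n y2) (comul y))) (comul b).
  by rewrite -TE can_map_convolution.
have T0 : T 0%N = 0.
  rewrite -TE; apply: (can_map_tower_trivial (phi := fun n => linear_of (jdL n))) => //.
    move=> n; rewrite !TE canT; apply: eq_tens_lift => x y.
    by rewrite right_antipode_cancel.
  rewrite TE canT; apply: big1 => p _.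
  by rewrite antipode_defect0_cancel linear0 linear0r.
apply/eqP; rewrite -subr_eq0; apply/eqP; apply: jinj.
rewrite rmorph0 -/(antipode_defect 0 b).
have := congr1 (contractl counit) T0; rewrite linear0 => <-.
rewrite -(counitl_lift b (jdL 0%N)) /T (lift_comp (h := contractl counit)); last by lin.
by apply: eq_tens_lift => x y; rewrite contractl_pure jB.2.
Qed.

End LeftAntipode.
End Antipode.

(** * Hopf algebras *)

Section HopfAlgebras.
Variable k : fieldType.

(** β intertwines the diagonal coaction with id ⊗ Δ, as
    x1 ⊗ x2 y1 ⊗ x3 y2 = (id ⊗ Δ)(x1 ⊗ x2 y). *)
Lemma can_map_coaction (B : bialgType k) (t : B ⊗ B) :
  tens_map (@can_map k B) idfun (coaction t) =
  tens_lift (fun x y => tens_lift (fun y1 y2 => (x ⊗ y1) ⊗ y2) (comul y)) (can_map t).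
Proof.
have cL := @coaction_linear _ B.
apply: (tens_ext (f := fun t => tens_map (@can_map k B) idfun (coaction t))
  (g := fun t => tens_lift (fun x y =>
    tens_lift (fun y1 y2 => (x ⊗ y1) ⊗ y2) (comul y)) (can_map t))) => [||x y].
- by lin.
- by lin.
rewrite coaction_pure can_map_pure [RHS]lift_lift; last by lin.
rewrite lift_comp; last by lin.
transitivity (tens_lift (fun x1 x2 => tens_lift (fun x11 x12 => tens_lift (fun y1 y2 =>
    (x11 ⊗ (x12 * y1)) ⊗ (x2 * y2)) (comul y)) (comul x1)) (comul x)).
  apply: eq_tens_lift => x1 x2; rewrite lift_comp; last by lin.
  rewrite [RHS]lift_exchange; apply: eq_tens_lift => y1 y2.
  rewrite tens_map_pure /= can_map_pure.
  by rewrite (@lift_comp _ _ _ _ _ (fun v => v ⊗ (x2 * y2))) //; lin.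
rewrite (@coassoc_lift _ _ _ (fun a b c => tens_lift (fun y1 y2 =>
    (a ⊗ (b * y1)) ⊗ (c * y2)) (comul y))); last by lin.
apply: eq_tens_lift => x1 x2; rewrite [RHS]tens_lift_pure; last by lin.
by rewrite comulM_lift //; lin.
Qed.

Variable H : hopfType k.

(** The inverse x ⊗ y |-> x1 ⊗ S(x2) y of the canonical map. *)
Definition can_inv (t : H ⊗ H) : H ⊗ H :=
  tens_lift (fun x y => tens_lift (fun x1 x2 => x1 ⊗ (antipode x2 * y)) (comul x)) t.

Lemma can_inv_linear : linear can_inv.
Proof. by rewrite /can_inv; lin. Qed.

Lemma can_mapK : cancel (@can_map k H) can_inv.
Proof.
have cL := can_inv_linear.
move=> t; apply: (tens_ext (f := fun t => can_inv (can_map t)) (g := fun t => t)) => [||x y].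
- by lin.
- by lin.
rewrite can_map_pure /can_inv lift_lift; last by lin.
under eq_tens_lift => x1 x2.
  rewrite tens_lift_pure; last by lin.
  over.
rewrite (@coassoc_lift _ _ _ (fun a b c => a ⊗ (antipode b * (c * y)))); last by lin.
rewrite -(@counitr_lift _ _ _ (fun x => x ⊗ y)); last by lin.
apply: eq_tens_lift => x1 x2.
transitivity (x1 ⊗ ((counit x2)%:A * y)); last first.
  by rewrite -scalerAl mul1r (linZ (f := fun z => x1 ⊗ z)) //; lin.
rewrite -antipodel (@lift_comp _ _ _ _ _ (fun z => x1 ⊗ (z * y))); last by lin.
by apply: eq_tens_lift => a b; rewrite mulrA.
Qed.

Lemma can_map_antipode (h : H) : can_map (tens_map idfun antipode (comul h)) = h ⊗ 1.
Proof.
rewrite can_map_comp (@coassoc_lift _ _ _ (fun a b c => a ⊗ (b * antipode c))); last by lin.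
rewrite -(@counitr_lift _ _ _ (fun x => x ⊗ 1)); last by lin.
apply: eq_tens_lift => x y.
transitivity (x ⊗ ((counit y)%:A : H)); last first.
  by rewrite (linZ (f := fun z => x ⊗ z)) //; lin.
by rewrite -antipoder (@lift_comp _ _ _ _ _ (fun z => x ⊗ z)) //; lin.
Qed.

(** Through the intertwining of can_map_coaction, coinvariance of the preimage of
    h ⊗ 1 under the injective β reduces to Δ(1) = 1 ⊗ 1. *)
Lemma hopf_coinvariants (h : H) : coinvariants H (tens_map idfun antipode (comul h)).
Proof.
rewrite /coinvariants /=.
have ciL := can_inv_linear.
have canK' : cancel (tens_map (@can_map k H) (idfun : H -> H))
    (tens_map (linear_of ciL) idfun).
  move=> t; rewrite tens_map_comp -[RHS]tens_map_id.
  by apply: eq_tens_map => // v /=; rewrite /linear_of can_mapK.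
apply: (can_inj canK'); rewrite can_map_coaction tens_map_pure /=.
rewrite can_map_antipode tens_lift_pure; last by lin.
by rewrite comul1 tens_lift_pure //; lin.
Qed.

Lemma hopf_im_pB h : im_pB H h.
Proof.
exists (tens_map idfun antipode (comul h)); first exact: hopf_coinvariants.
have := can_map_coinvariants (hopf_coinvariants h).
rewrite can_map_antipode => /(congr1 (contractr counit)).
by rewrite !contractr_pure counit1 !scale1r.
Qed.

Lemma hopf_K h : K H h.
Proof. by apply/KP => g; apply: hopf_im_pB. Qed.

(** Both sides equal S(f(h1)) f(h2) f(S(h3)): convolution inverses are unique. *)
Lemma bialg_morphism_antipode (H' : hopfType k) (f : {lrmorphism H -> H'}) :
  bialg_morphism f -> forall h, f (antipode h) = antipode (f h).
Proof.
move=> fB h; symmetry.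
have := @coassoc_lift _ _ _ (fun x y z => antipode (f x) * (f y * f (antipode z))) h.
move=> E; transitivity (tens_lift (fun x y => tens_lift (fun y1 y2 =>
   antipode (f x) * (f y1 * f (antipode y2))) (comul y)) (comul h)).
  rewrite -[LHS](@counitr_lift _ _ _ (fun x => antipode (f x))); last by lin.
  apply: eq_tens_lift => x y.
  transitivity (antipode (f x) * f (counit y)%:A).
    by rewrite linearZ /= rmorph1 -scalerAr mulr1.
  rewrite -antipoder (@lift_comp _ _ _ _ _ (fun z => antipode (f x) * f z)); last by lin.
  by apply: eq_tens_lift => y1 y2; rewrite rmorphM.
rewrite -E; last by lin.
rewrite -[RHS](@counitl_lift _ _ _ (fun x => f (antipode x))); last by lin.
apply: eq_tens_lift => x y.
transitivity ((counit (f x))%:A * f (antipode y)); last by rewrite fB.2 -scalerAl mul1r.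
rewrite -antipodel fB.1 lift_map; last by lin.
rewrite (@lift_comp _ _ _ _ _ (fun z => z * f (antipode y))); last by lin.
by apply: eq_tens_lift => x1 x2; rewrite mulrA.
Qed.

End HopfAlgebras.

(** * The iterates of K and their intersection *)

Section HopfOf.
Variables (k : fieldType) (P : bialgType k) (S : {linear P -> P}).
Hypothesis Sl : forall b,
  tens_lift (fun x y => S x * y) (comul b) = (counit b)%:A.
Hypothesis Sr : forall b,
  tens_lift (fun x y => x * S y) (comul b) = (counit b)%:A.

(** The identities of the antipode are parameters of the type, so that the Hopf
    algebra structure can be attached to it. *)
Definition hopf_of
  of (forall b, tens_lift (fun x y => S x * y) (comul b) = (counit b)%:A)
  & (forall b, tens_lift (fun x y => x * S y) (comul b) = (counit b)%:A) : Type := P.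

HB.instance Definition _ := Bialgebra.copy (hopf_of Sl Sr) P.
HB.instance Definition _ := isHopfAlgebra.Build k (hopf_of Sl Sr) Sl Sr.

End HopfOf.

Section Kiter.
Variables (k : fieldType) (B : bialgType k).

(** The existential definition does not depend on the bialgebra presenting K^m(B):
    two presentations are related by a bialgebra map, and K is functorial. *)
Lemma KiterS (A : bialgType k) (j : {lrmorphism A -> B}) m :
  subbialg j (Kiter B m) -> Kiter B m.+1 = j @` K A.
Proof.
move=> jK; apply/seteqP; split=> [_ [A' [j' [j'K [a' Ka' <-]]]] | b Kb]; last first.
  by exists A, j.
have [j'B _ j'R] := j'K.
have j'S a : Kiter B m (j' a) by rewrite -[Kiter B m]j'R; exists a.
have [g gB gE] := bialg_morphism_factor j'B jK j'S.
by exists (g a'); [apply: K_map | apply: gE].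
Qed.

Lemma Kiter_subbialg_set m : subbialg_set (Kiter B m).
Proof.
elim: m => [|m /subbialg_exists[A [j jK]]]; first by split.
rewrite (KiterS jK); apply: image_subbialg_set; first by case: jK.
exact: K_subbialg_set.
Qed.

Lemma Kinfty_subbialg_set : subbialg_set (Kinfty B).
Proof.
split.
- by move=> a x y Kx Ky m _; apply: (subbialg_submodule (Kiter_subbialg_set m)); [apply: Kx | apply: Ky].
- by move=> m _; apply: subbialg1 (Kiter_subbialg_set m).
- by move=> x y Kx Ky m _; apply: (subbialgM (Kiter_subbialg_set m)); [apply: Kx | apply: Ky].
- by move=> g b Kb m _; apply: (subbialg_contractl (Kiter_subbialg_set m)); apply: Kb.
- by move=> g b Kb m _; apply: (subbialg_contractr (Kiter_subbialg_set m)); apply: Kb.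
Qed.

(** H = K(H), and K is functorial. *)
Lemma hopf_image_Kinfty (H : hopfType k) (f : {lrmorphism H -> B}) h :
  bialg_morphism f -> Kinfty B (f h).
Proof.
move=> fB m _; elim: m h => [//|m IHm] h.
have [A [j jK]] := subbialg_exists (Kiter_subbialg_set m).
have [g gB gE] := bialg_morphism_factor fB jK IHm.
rewrite (KiterS jK) -gE; exists (g h) => //.
exact/(K_map gB)/hopf_K.
Qed.

Lemma Kiter_coinvariant_lift m b : Kiter B m.+1 b ->
  exists t, [/\ coinvariants B t, pB t = b,
    forall g, Kiter B m (contractl g t) & forall g, Kiter B m (contractr g t)].
Proof.
have [A [j jK]] := subbialg_exists (Kiter_subbialg_set m).
have [jB jinj jR] := jK.
rewrite (KiterS jK) => -[a /K_im_pB[t tco <-] <-].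
exists (tens_map j j t); split.
- exact: coinvariants_map.
- exact: pB_map.
- by move=> g; rewrite contractl_map -jR; eexists.
- by move=> g; rewrite contractr_map -jR; eexists.
Qed.

(** The coinvariant preimages of b taken in the various K^m(B) ⊗ K^m(B) coincide in
    B ⊗ B by pB_injective, so a single tensor lies in all of them. *)
Lemma Kinfty_coinvariant_lift (P : bialgType k) (j : {lrmorphism P -> B}) :
  right_perfect B -> subbialg j (Kinfty B) -> forall b, im_pB P b.
Proof.
move=> hB [jB jinj jR] b.
have Kb : Kinfty B (j b) by rewrite -jR; exists b.
have [t0 [t0co t0b _ _]] := Kiter_coinvariant_lift (Kb 1%N I).
have t0K m : (forall g, Kiter B m (contractl g t0)) /\
    (forall g, Kiter B m (contractr g t0)).
  have [t [tco tb tl tr]] := Kiter_coinvariant_lift (Kb m.+1 I).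
  by rewrite (pB_injective hB t0co tco) // tb.
have [||t tE] := tens_map_range (j := j) (t := t0) jinj.
- by move=> g; rewrite jR => m _; have [] := t0K m.
- by move=> g; rewrite jR => m _; have [] := t0K m.
exists t; first by apply: (coinvariants_reflect jB) => //; rewrite tE.
by apply: jinj; rewrite -pB_map // tE.
Qed.

Lemma Kinfty_hopf (P : bialgType k) (j : {lrmorphism P -> B}) :
    right_perfect B -> subbialg j (Kinfty B) ->
  exists (C : hopfType k) (iota : {lrmorphism C -> B}), subbialg iota (Kinfty B).
Proof.
move=> hB jK; have [jB jinj jR] := jK.
have [t u tco uco tu|S Sr] := right_antipode_exists (Kinfty_coinvariant_lift hB jK).
  apply: (tens_map_inj jinj jinj); apply: (pB_injective hB).
  - exact: coinvariants_map.
  - exact: coinvariants_map.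
  - by rewrite !pB_map // tu.
have Sl := left_antipode jB jinj (right_perfect_principal_dcc hB) Sr.
by exists (hopf_of Sl Sr : hopfType k), j.
Qed.

End Kiter.

Theorem theorem3p39 (k : fieldType) (B : bialgType k) (hB : right_perfect B) :
  exists (C : hopfType k) (iota : {lrmorphism C -> B}),
    subbialg iota (Kinfty B) /\ is_cofree_hopf iota.
Proof.
have [P [j jK]] := subbialg_exists (Kinfty_subbialg_set B).
have [C [iota iK]] := Kinfty_hopf hB jK.
exists C, iota; split=> //; have [iB iinj _] := iK; split=> // H f fB.
have [g gB gE] := bialg_morphism_factor fB iK (fun h => hopf_image_Kinfty h fB).
exists g; split=> //.
- by split=> //; apply: bialg_morphism_antipode.
- by move=> g' _ g'E h; apply: iinj; rewrite gE -g'E.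
Qed.
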